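(* Given $C\in\mathbb{R}^{m\times n}$ and a positive integer $r\le\min\{m,n\}$, one can (explicitly) construct an unbiased approximator $C'$ of $C$ such that $C'$ always has rank at most $r$, and such that $C'$ has minimal variance among all such unbiased approximators: that is, $\mathrm{E}[C']=C$, $\mathrm{rank}(C')\le r$ always, and $\mathrm{Var}[C']\le\mathrm{Var}[Y]$ for every random matrix $Y\in\mathbb{R}^{m\times n}$ with $\mathrm{E}[Y]=C$ and $\mathrm{rank}(Y)\le r$ with probability $1$. This can be achieved asymptotically in the same runtime as computing the singular value decomposition of $C$.
   Context: For a random matrix $X'$ and a fixed matrix $X$ of the same size, $X'$ is an unbiased approximator of $X$ if $\mathrm{E}[X']=X$; the variance is $\mathrm{Var}[X']=\mathrm{E}[\|X'-\mathrm{E}[X']\|^2]$ with $\|\cdot\|$ the Frobenius norm. *)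

(* Defs.v *)
From HB Require Import structures.
From mathcomp Require Import all_boot all_order all_algebra.
From mathcomp Require Import all_classical all_reals all_analysis.

Set Implicit Arguments.
Unset Strict Implicit.
Unset Printing Implicit Defensive.

Import Order.TTheory GRing.Theory Num.Theory.
Local Open Scope classical_set_scope.
Local Open Scope ring_scope.

Section RandomMatrix.
Context {R : realType}.

Definition frobenius_norm m n (A : 'M[R]_(m, n)) : R :=
  Num.sqrt (\sum_i \sum_j A i j ^+ 2).

Section OnAProbabilitySpace.
Context {d : measure_display} {T : measurableType d} (P : probability T R).
Context {m n : nat}.
Implicit Types (X : T -> 'M[R]_(m, n)) (C : 'M[R]_(m, n)).

Definition random_matrix X : Prop :=
  forall i j, measurable_fun setT (fun w => X w i j).

Definition mx_integrable X : Prop :=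
  forall i j, P.-integrable setT (EFin \o (fun w => X w i j)).

(* Meaningful only when [mx_integrable X]. *)
Definition mx_expectation X : 'M[R]_(m, n) :=
  \matrix_(i, j) fine ('E_P[fun w => X w i j]).

(* The value +oo is allowed. *)
Definition mx_variance X : \bar R :=
  (\int[P]_w ((frobenius_norm (X w - mx_expectation X)) ^+ 2)%:E)%E.

Definition unbiased_approximator X C : Prop :=
  [/\ random_matrix X, mx_integrable X & mx_expectation X = C].

End OnAProbabilitySpace.

(* The competitors Y live on arbitrary probability spaces, which need not be
   the one carrying X, and have rank at most r only almost surely. *)
Definition optimal_approximator d (T : measurableType d) (P : probability T R)
    m n (X : T -> 'M[R]_(m, n)) (C : 'M[R]_(m, n)) (r : nat) : Prop :=
  [/\ unbiased_approximator P X C,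
      forall w, (\rank (X w) <= r)%N
    & forall d' (T' : measurableType d') (P' : probability T' R)
        (Y : T' -> 'M[R]_(m, n)),
        unbiased_approximator P' Y C ->
        {ae P', forall w, (\rank (Y w) <= r)%N} ->
        (mx_variance P X <= mx_variance P' Y)%E].

Definition iid_uniform d (T : measurableType d) (P : probability T R)
    (u : nat -> {RV P >-> R}) : Prop :=
  (forall k (A : set R), measurable A ->
     distribution P (u k) A = uniform_prob (@ltr01 R) A) /\
  (forall q (A : nat -> set R), (forall k, measurable (A k)) ->
     P [set w | forall k, (k < q)%N -> A k (u k w)]
     = (\prod_(k < q) P (u k @^-1` A k))%E).

End RandomMatrix.

Section SVD.
Variable R : realType.

Definition is_svd m n (C : 'M[R]_(m, n)) (U : 'M[R]_(m, minn m n))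
    (s : 'rV[R]_(minn m n)) (V : 'M[R]_(n, minn m n)) : Prop :=
  [/\ U^T *m U = 1%:M, V^T *m V = 1%:M,
      forall i, 0 <= s 0 i,
      forall i j : 'I_(minn m n), (i <= j)%N -> s 0 j <= s 0 i
    & C = U *m diag_mx s *m V^T].

Record svd_result m n := SvdResult {
  left_vectors : 'M[R]_(m, minn m n);
  singular_values : 'rV[R]_(minn m n);
  right_vectors : 'M[R]_(n, minn m n) }.

Definition svd_solver := forall m n, 'M[R]_(m, n) -> svd_result m n.

Definition svd_correct (svd : svd_solver) : Prop :=
  forall m n (C : 'M[R]_(m, n)),
    is_svd C (left_vectors (svd m n C)) (singular_values (svd m n C))
      (right_vectors (svd m n C)).

End SVD.

(* A randomized real RAM with an SVD primitive.

   Programs are finite syntactic objects, fixed once and for all inputs.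
   Storage consists of natural-number registers and of two-dimensional real
   arrays, both numbered by [nat].  Reals are accessible only through exact
   field operations, comparisons, i.i.d. uniform draws and the SVD primitive.
   Loops are bounded, so that execution is a total function. *)

Inductive nat_expr : Type :=
| NReg of nat
| NConst of nat
| NAdd of nat_expr & nat_expr
| NSub of nat_expr & nat_expr.

Inductive real_expr : Type :=
| RCell of nat & nat_expr & nat_expr
| RNat of nat_expr
| RAdd of real_expr & real_expr
| RSub of real_expr & real_expr
| RMul of real_expr & real_expr
| RDiv of real_expr & real_expr.

Inductive test : Type :=
| NLe of nat_expr & nat_expr
| RLe of real_expr & real_expr.

Inductive program : Type :=
| Skip
| Seq of program & program
| SetN of nat & nat_expr
| SetR of nat & nat_expr & nat_expr & real_expr
| Draw of nat & nat_expr & nat_expr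
| If of test & program & program
| For of nat & nat_expr & program
(* [Svd a u s v e1 e2] reads array [a] as an [e1]-by-[e2] matrix and
   overwrites the arrays [u], [s] (in its row 0) and [v]. *)
| Svd of nat & nat & nat & nat & nat_expr & nat_expr.

Section Semantics.
Variable R : realType.

Record state := State {
  reg : nat -> nat;
  arr : nat -> nat -> nat -> R;
  draws : nat;
  time : nat }.

Definition tick c (st : state) : state :=
  State (reg st) (arr st) (draws st) (time st + c).

Definition set_reg x v (st : state) : state :=
  State (fun y => if y == x then v else reg st y)
        (arr st) (draws st) (time st).

Definition set_arr a (X : nat -> nat -> R) (st : state) : state :=
  State (reg st) (fun b => if b == a then X else arr st b)
        (draws st) (time st).

Definition set_cell a i j (x : R) (st : state) : state :=
  set_arr a
    (fun k l => if (k == i) && (l == j) then x else arr st a k l) st.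

Definition mx_of_array m n (X : nat -> nat -> R) : 'M[R]_(m, n) :=
  \matrix_(i < m, j < n) X i j.

Definition array_of_mx m n (A : 'M[R]_(m, n)) (i j : nat) : R :=
  match insub i, insub j with
  | Some i', Some j' => A i' j'
  | _, _ => 0
  end.

Fixpoint nat_eval (st : state) (e : nat_expr) : nat :=
  match e with
  | NReg x => reg st x
  | NConst c => c
  | NAdd e1 e2 => nat_eval st e1 + nat_eval st e2
  | NSub e1 e2 => nat_eval st e1 - nat_eval st e2
  end%N.

Fixpoint real_eval (st : state) (e : real_expr) : R :=
  match e with
  | RCell a e1 e2 => arr st a (nat_eval st e1) (nat_eval st e2)
  | RNat e1 => (nat_eval st e1)%:R
  | RAdd e1 e2 => real_eval st e1 + real_eval st e2
  | RSub e1 e2 => real_eval st e1 - real_eval st e2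
  | RMul e1 e2 => real_eval st e1 * real_eval st e2
  | RDiv e1 e2 => real_eval st e1 / real_eval st e2
  end.

Definition test_eval (st : state) (b : test) : bool :=
  match b with
  | NLe e1 e2 => (nat_eval st e1 <= nat_eval st e2)%N
  | RLe e1 e2 => real_eval st e1 <= real_eval st e2
  end.

Variables (svd : svd_solver R) (svd_time : nat -> nat -> nat).
Variable tape : nat -> R.

(* One time unit per executed instruction and per loop iteration, and
   [svd_time m n] for the SVD of an m-by-n matrix.  Since the expressions
   occurring in a program have a size independent of the input, counting the
   operations inside expressions would only change running times by a constant
   factor depending on the program. *)
Fixpoint exec (c : program) (st : state) : state :=
  match c with
  | Skip => st
  | Seq c1 c2 => exec c2 (exec c1 st)
  | SetN x e => tick 1 (set_reg x (nat_eval st e) st)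
  | SetR a e1 e2 e =>
      tick 1 (set_cell a (nat_eval st e1) (nat_eval st e2) (real_eval st e) st)
  | Draw a e1 e2 =>
      let st1 := set_cell a (nat_eval st e1) (nat_eval st e2)
                   (tape (draws st)) st in
      State (reg st1) (arr st1) (draws st1).+1 (time st1).+1
  | If b c1 c2 =>
      if test_eval st b then exec c1 (tick 1 st) else exec c2 (tick 1 st)
  | For x e c1 =>
      iteri (nat_eval st e) (fun i s => exec c1 (tick 1 (set_reg x i s)))
        (tick 1 st)
  | Svd a u s v e1 e2 =>
      let m := nat_eval st e1 in
      let n := nat_eval st e2 in
      let D := svd (mx_of_array m n (arr st a)) in
      tick (svd_time m n)
        (set_arr v (array_of_mx (right_vectors D))
          (set_arr s (array_of_mx (singular_values D))
            (set_arr u (array_of_mx (left_vectors D)) st)))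
  end.

(* Registers 0, 1, 2 hold m, n, r and array 0 holds C; everything else is 0. *)
Definition initial_state m n (C : 'M[R]_(m, n)) (r : nat) : state :=
  State (fun x => nth 0%N [:: m; n; r] x)
        (fun a => if a == 0%N then array_of_mx C else fun _ _ => 0) 0 0.

Definition run (c : program) m n (C : 'M[R]_(m, n)) (r : nat) : state :=
  exec c (initial_state C r).

End Semantics.

Section Algorithm.
Variable R : realType.

(* The two usual ways of returning an m-by-n matrix of rank at most r: as its
   array of entries (array 1), or as the product of an m-by-r matrix (array 1)
   and an r-by-n matrix (array 2). *)
Definition explicit_output m n (r : nat) (st : state R) : 'M[R]_(m, n) :=
  mx_of_array m n (arr st 1).

Definition factored_output m n (r : nat) (st : state R) : 'M[R]_(m, n) :=
  mx_of_array m r (arr st 1) *m mx_of_array r n (arr st 2).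

(* For every SVD routine whose running time [svd_time] is at least
   [svd_lower_bound], the program, run with access to that routine, returns an
   optimal approximator within worst-case time [K * svd_time m n]. *)
Definition optimal_in_svd_time (c : program) (K : nat)
    (output : forall m n (r : nat), state R -> 'M[R]_(m, n))
    (svd_lower_bound : nat -> nat -> nat) : Prop :=
  forall (svd : svd_solver R) (svd_time : nat -> nat -> nat),
    svd_correct svd ->
    (forall m n, (svd_lower_bound m n <= svd_time m n)%N) ->
  forall m n (C : 'M[R]_(m, n)) (r : nat), (0 < r <= minn m n)%N ->
    (forall tape : nat -> R,
       (time (run svd svd_time tape c C r) <= K * svd_time m n)%N) /\
    (forall d (T : measurableType d) (P : probability T R)
       (u : nat -> {RV P >-> R}), iid_uniform u ->
       optimal_approximator P
         (fun w => output m n r (run svd svd_time (fun k => u k w) c C r))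
         C r).

End Algorithm.

(* Main.v *)
Require Import Defs.
From mathcomp Require Import all_boot all_order all_algebra.
From mathcomp Require Import all_classical all_reals all_analysis.
From mathcomp Require Import measurable_realfun.
From mathcomp Require Import ring lra zify.

Import Order.TTheory GRing.Theory Num.Theory.
Import numFieldNormedType.Exports.

Set Implicit Arguments.
Unset Strict Implicit.
Unset Printing Implicit Defensive.

(* Let [C] have the singular values [sigma i], [i < q].  Given a water level
   [t >= 0], put [b i = max (sigma i) t] and [p i = sigma i / b i].  Dropping
   the terms of the decomposition of [C] at random, keeping the [i]-th one with
   probability [p i] and singular value [b i], gives an unbiased [X].  When
   [t] is chosen so that the [p i] add up to [r] (or [t = 0] and they add up to
   at most [r]), systematic sampling with a single uniform variable [theta]
   keeps at most [r] terms: the [i]-th term is kept iff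
   [theta + p 0 + ... + p i] has a larger integer part than
   [theta + p 0 + ... + p (i - 1)].

   Optimality is a duality argument.  With [B] the matrix with singular values
   [b i] and the singular vectors of [C], every [Y] of rank at most [r]
   satisfies [2 <Y, B> - |Y|^2 <= \sum_i (b i ^ 2 - t ^ 2) + r t ^ 2], with
   equality for [Y = X w].  Thus [|Y - C|^2] is bounded below by an affine
   function of [Y], whose expectation depends on [E[Y] = C] only.

   The level [t] is found by scanning the decreasing [sigma]: if the [k] largest
   values stay above the level, then [t] is the sum of the others divided by
   [r - k]. *)

Local Open Scope classical_set_scope.
Local Open Scope ring_scope.

(** * The Frobenius inner product and a bound for low-rank matrices *)

Section FrobeniusInnerProduct.
Variable R : realType.

Definition mxdot m n (A B : 'M[R]_(m, n)) : R := \tr (A^T *m B).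

Lemma mxdotE m n (A B : 'M[R]_(m, n)) :
  mxdot A B = \sum_i \sum_j A i j * B i j.
Proof.
rewrite exchange_big; apply: eq_bigr => j _; rewrite !mxE.
by apply: eq_bigr => i _; rewrite mxE.
Qed.

Lemma mxdotC m n (A B : 'M[R]_(m, n)) : mxdot A B = mxdot B A.
Proof. by rewrite /mxdot -mxtrace_tr trmx_mul trmxK. Qed.

Lemma mxdotDl m n (A B C : 'M[R]_(m, n)) :
  mxdot (A + B) C = mxdot A C + mxdot B C.
Proof. by rewrite /mxdot raddfD mulmxDl raddfD. Qed.

Lemma mxdotNl m n (A B : 'M[R]_(m, n)) : mxdot (- A) B = - mxdot A B.
Proof. by rewrite /mxdot raddfN mulNmx raddfN. Qed.

Lemma mxdotZl m n a (A B : 'M[R]_(m, n)) : mxdot (a *: A) B = a * mxdot A B.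
Proof. by rewrite /mxdot linearZ -scalemxAl mxtraceZ. Qed.

Lemma mxdotDr m n (A B C : 'M[R]_(m, n)) :
  mxdot A (B + C) = mxdot A B + mxdot A C.
Proof. by rewrite mxdotC mxdotDl !(mxdotC A). Qed.

Lemma mxdotNr m n (A B : 'M[R]_(m, n)) : mxdot A (- B) = - mxdot A B.
Proof. by rewrite mxdotC mxdotNl mxdotC. Qed.

Lemma mxdotZr m n a (A B : 'M[R]_(m, n)) : mxdot A (a *: B) = a * mxdot A B.
Proof. by rewrite mxdotC mxdotZl mxdotC. Qed.

Lemma mxdot0l m n (B : 'M[R]_(m, n)) : mxdot 0 B = 0.
Proof. by rewrite -(scale0r 0) mxdotZl mul0r. Qed.

Lemma mxdot_mull m n p (M : 'M[R]_(m, p)) (A : 'M[R]_(p, n)) B :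
  mxdot (M *m A) B = mxdot A (M^T *m B).
Proof. by rewrite /mxdot trmx_mul mulmxA. Qed.

Lemma mxdot_ge0 m n (A : 'M[R]_(m, n)) : 0 <= mxdot A A.
Proof.
rewrite mxdotE; apply: sumr_ge0 => i _; apply: sumr_ge0 => j _.
exact: sqr_ge0.
Qed.

Lemma mxdot_eq0 m n (A : 'M[R]_(m, n)) : mxdot A A = 0 -> A = 0.
Proof.
have sq_ge0 i : 0 <= \sum_j A i j * A i j.
  by apply: sumr_ge0 => j _; exact: sqr_ge0.
rewrite mxdotE => /eqP; rewrite psumr_eq0 => [/allP A0|i _]; last exact: sq_ge0.
apply/matrixP => i j; rewrite mxE.
have /= := A0 i (mem_index_enum i).
rewrite psumr_eq0 => [/allP/(_ j (mem_index_enum j))/=|l _]; last first.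
  exact: sqr_ge0.
by rewrite mulf_eq0 orbb => /eqP.
Qed.

Lemma frobenius_norm_sqr m n (A : 'M[R]_(m, n)) :
  frobenius_norm A ^+ 2 = mxdot A A.
Proof.
rewrite mxdotE sqr_sqrtr //.
by apply: sumr_ge0 => i _; apply: sumr_ge0 => j _; exact: sqr_ge0.
Qed.

Lemma mxdot_svd m n q (U : 'M[R]_(m, q)) (V : 'M[R]_(n, q)) (x y : 'rV[R]_q) :
  U^T *m U = 1%:M -> V^T *m V = 1%:M ->
  mxdot (U *m diag_mx x *m V^T) (U *m diag_mx y *m V^T) =
    \sum_i x 0 i * y 0 i.
Proof.
move=> UU VV; rewrite /mxdot !trmx_mul trmxK -!mulmxA mxtrace_mulC !mulmxA.
rewrite -(mulmxA _ U^T) UU mulmx1 -(mulmxA _ V^T) VV mulmx1.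
by apply: eq_bigr => i _; rewrite tr_diag_mx mul_diag_mx !mxE eqxx.
Qed.

(** For a full-rank factorisation [Y = L M], [Q = L (L^T L)^-1 L^T] is the orthogonal projection
    onto the columns of [Y]; by cyclicity its trace is that of the identity of size [\rank Y]. *)
Lemma colspace_projection m n (Y : 'M[R]_(m, n)) :
  exists Q : 'M[R]_m,
    [/\ Q^T = Q, Q *m Q = Q, Q *m Y = Y & \tr Q = (\rank Y)%:R].
Proof.
have [L [M [YE fL]]] : exists (L : 'M[R]_(m, \rank Y)) M,
    Y = L *m M /\ row_free L^T.
  exists (col_base Y), (row_base Y); rewrite mulmx_base; split=> //.
  by rewrite -row_leq_rank mxrank_tr (eqP (col_base_full Y)).
(* If [v L^T L = 0], then [|v L^T|^2 = 0], and [v = 0] because [L^T] is row free. *)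
have uG : L^T *m L \in unitmx.
  rewrite -row_free_unit; apply: inj_row_free => v vG0.
  apply: (row_free_inj fL); rewrite mul0mx.
  apply/trmx_inj; rewrite trmx0; apply: mxdot_eq0.
  by rewrite /mxdot trmxK trmx_mul trmxK -mulmxA (mulmxA L^T) mulmxA vG0
             mul0mx raddf0.
exists (L *m invmx (L^T *m L) *m L^T); split.
- by rewrite !trmx_mul trmxK trmx_inv trmx_mul trmxK mulmxA.
- by rewrite !mulmxA -(mulmxA _ L^T L) mulmxKV.
- have -> : L *m invmx (L^T *m L) *m L^T *m Y =
      L *m invmx (L^T *m L) *m (L^T *m L) *m M.
    by rewrite !mulmxA -[in RHS]mulmxA -YE.
  by rewrite mulmxKV.
- by rewrite -mulmxA mxtrace_mulC -mulmxA mulVmx// mxtrace1.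
Qed.

(* The Ky Fan bound [2 <Y, B> - |Y|^2 <= |Q B|^2], where [Q] is the projection
   onto the columns of [Y]; the weights [c i = <u_i, Q u_i>] lie in [0, 1] and
   add up to at most [\rank Y]. *)
Lemma low_rank_bound m n q (U : 'M[R]_(m, q)) (V : 'M[R]_(n, q)) (b : 'rV[R]_q)
    (t : R) (r : nat) (Y : 'M[R]_(m, n)) :
  U^T *m U = 1%:M -> V^T *m V = 1%:M -> 0 <= t -> (forall i, t <= b 0 i) ->
  (\rank Y <= r)%N ->
  2 * mxdot Y (U *m diag_mx b *m V^T) - mxdot Y Y <=
    \sum_i (b 0 i ^+ 2 - t ^+ 2) + t ^+ 2 * r%:R.
Proof.
move=> UU VV t0 tb rY; set B := _ *m V^T.
have [Q [QT QQ QY trQ]] := colspace_projection Y.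
(* The diagonal of [W] carries the weights: [W i i = |Q u_i|^2] and
   [1 - W i i = |(1 - Q) u_i|^2]. *)
pose W := U^T *m Q *m U.
have WE : W = (Q *m U)^T *m (Q *m U).
  by rewrite trmx_mul QT !mulmxA -(mulmxA U^T) QQ.
have NQ : (1%:M - Q) *m (1%:M - Q) = 1%:M - Q.
  by rewrite mulmxBl mul1mx mulmxBr mulmx1 QQ subrr subr0.
have NU : (1%:M - U *m U^T) *m (1%:M - U *m U^T) = 1%:M - U *m U^T.
  rewrite mulmxBl mul1mx mulmxBr mulmx1 mulmxA -(mulmxA U) UU mulmx1.
  by rewrite subrr subr0.
have c0 i : 0 <= W i i.
  by rewrite WE mxE sumr_ge0// => j _; rewrite mxE sqr_ge0.
have c1 i : W i i <= 1.
  have -> : W = 1%:M - ((1%:M - Q) *m U)^T *m ((1%:M - Q) *m U).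
    rewrite trmx_mul linearB/= QT trmx1 !mulmxA -(mulmxA U^T) NQ.
    by rewrite mulmxBr mulmx1 mulmxBl UU opprB addrC subrK.
  rewrite !mxE eqxx lerBlDr lerDl sumr_ge0// => j _.
  by rewrite mxE sqr_ge0.
(* The gap [\tr Q - \tr W] is [|Q (1 - U U^T)|^2]. *)
have sum_c : \sum_i W i i <= r%:R.
  apply: (@le_trans _ _ (\tr Q)); last by rewrite trQ ler_nat.
  rewrite -subr_ge0 -/(mxtrace W) /W mxtrace_mulC mulmxA mxtrace_mulC.
  have -> : \tr Q - \tr (Q *m (U *m U^T)) = \tr (Q *m (1%:M - U *m U^T)).
    by rewrite mulmxBr mulmx1 raddfB.
  rewrite -NU mulmxA mxtrace_mulC -QQ -!mulmxA mulmxA.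
  have := mxdot_ge0 (Q *m (1%:M - U *m U^T)); rewrite /mxdot.
  by rewrite trmx_mul QT linearB/= trmx1 trmx_mul trmxK !mulmxA.
have YB : mxdot Y B = mxdot Y (Q *m B) by rewrite -{1}QY mxdot_mull QT.
have QB : mxdot (Q *m B) (Q *m B) = \sum_i b 0 i ^+ 2 * W i i.
  rewrite mxdot_mull QT mulmxA QQ /mxdot /B !trmx_mul trmxK -!mulmxA.
  rewrite mxtrace_mulC !mulmxA -(mulmxA _ V^T V) VV mulmx1.
  rewrite -(mulmxA _ U^T Q) -(mulmxA _ _ U) -/W.
  apply: eq_bigr => i _; rewrite tr_diag_mx mul_mx_diag mul_diag_mx !mxE.
  by rewrite mulrAC -expr2.
(* Expand [|Y - Q B|^2 >= 0], using [<Y, Q B> = <Y, B>]. *)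
have : 2 * mxdot Y B - mxdot Y Y <= mxdot (Q *m B) (Q *m B).
  have := mxdot_ge0 (Y - Q *m B).
  rewrite mxdotDl !mxdotDr !mxdotNl !mxdotNr -(mxdotC Y) -YB; lra.
move=> /le_trans; apply; rewrite QB.
apply: (@le_trans _ _ (\sum_i ((b 0 i ^+ 2 - t ^+ 2) + t ^+ 2 * W i i))).
  apply: ler_sum => i _; rewrite -subr_ge0.
  have -> : b 0 i ^+ 2 - t ^+ 2 + t ^+ 2 * W i i - b 0 i ^+ 2 * W i i =
            (b 0 i ^+ 2 - t ^+ 2) * (1 - W i i) by ring.
  by rewrite mulr_ge0// subr_ge0// ler_sqr// nnegrE// (le_trans t0).
by rewrite big_split/= lerD2l -mulr_sumr ler_wpM2l// sqr_ge0.
Qed.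

End FrobeniusInnerProduct.

(** * Existence of the singular value decomposition *)

Section SingularValueDecomposition.
Variable R : realType.

Lemma continuous_sum (T : topologicalType) (I : Type) (s : seq I)
    (F : I -> T -> R) :
  (forall i, continuous (F i)) -> continuous (fun x => \sum_(i <- s) F i x).
Proof.
move=> cF; elim: s => [|i s IHs] x.
  by under eq_fun do rewrite big_nil; exact: cst_continuous.
under eq_fun do rewrite big_cons.
by apply: cvgD; [exact: cF|exact: IHs].
Qed.

Lemma continuous_mxdot_mulmx n p (M : 'M[R]_(n, p)) :
  continuous (fun x : 'rV[R]_n => mxdot (x *m M) (x *m M)).
Proof.
under eq_fun do rewrite mxdotE.
apply: continuous_sum => i; apply: continuous_sum => j x.
have cE : continuous (fun x : 'rV[R]_n => (x *m M) i j).
  under eq_fun do rewrite mxE.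
  apply: continuous_sum => k y; 
  apply: (@continuousM R _ (fun x : 'rV[R]_n => x i k) (fun=> M k j)).
    exact: coord_continuous.
  exact: cst_continuous.
by apply: (@continuousM R _ (fun x : 'rV[R]_n => (x *m M) i j)
  (fun x : 'rV[R]_n => (x *m M) i j)); exact: cE.
Qed.

Lemma exists_unit_kernel n k (V : 'M[R]_(n, k)) : (k < n)%N ->
  exists x : 'rV[R]_n, x *m V = 0 /\ mxdot x x = 1.
Proof.
move=> kn.
have : kermx V != 0.
  rewrite kermx_eq0 -row_leq_rank -ltnNge.
  exact: leq_ltn_trans (rank_leq_col V) kn.
move=> /rowV0Pn[v /sub_kermxP vV v0].
exists ((Num.sqrt (mxdot v v))^-1 *: v); rewrite -scalemxAl vV scaler0.
split=> //; rewrite mxdotZl mxdotZr mulrA -invfM -expr2 sqr_sqrtr ?mxdot_ge0//.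
by rewrite mulVf//; apply: contra v0 => /eqP/mxdot_eq0 ->.
Qed.

(** The unit vectors orthogonal to [V] form a nonempty compact set, on which [|C x|^2] attains its
    maximum; homogeneity extends the bound to every [y] orthogonal to [V]. *)
Lemma exists_unit_kernel_max m n k (C : 'M[R]_(m, n)) (V : 'M[R]_(n, k)) :
  (k < n)%N ->
  exists x : 'cV[R]_n,
    [/\ V^T *m x = 0, mxdot x x = 1
      & forall y : 'cV[R]_n, V^T *m y = 0 ->
          mxdot (C *m y) (C *m y) <= mxdot (C *m x) (C *m x) * mxdot y y].
Proof.
move=> kn.
have trdot (a b : nat) (A B : 'M[R]_(a, b)) : mxdot A^T B^T = mxdot A B.
  by rewrite /mxdot trmxK mxtrace_mulC -mxtrace_tr trmx_mul trmxK.
(* Row vectors are used because [EVT_max_rV] is about them; the factor [1%:M] gives both constraints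
   the shape treated by [closed_level]. *)
pose A := [set x : 'rV[R]_n | mxdot (x *m V) (x *m V) = 0] `&`
          [set x | mxdot (x *m 1%:M) (x *m 1%:M) = 1].
have A_compact : compact A.
  apply: bounded_closed_compact.
    exists 1; split=> // a a1 x [_ /=]; rewrite mulmx1 => x1.
    apply: le_trans (ltW a1); rewrite /Num.norm/= mx_normrE.
    apply: bigmax_le => // -[i j] _ /=.
    rewrite -(ler_sqr (normr_ge0 _))// ?nnegrE// real_normK ?num_real//.
    rewrite expr1n -x1 mxdotE (bigD1 i)//= (bigD1 j)//= -expr2 -addrA lerDl.
    rewrite addr_ge0// sumr_ge0// => l _; rewrite ?sumr_ge0// => *;
      exact: sqr_ge0.
  have closed_level p (M : 'M[R]_(n, p)) c :
      closed [set x : 'rV[R]_n | mxdot (x *m M) (x *m M) = c].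
    apply: (@preimage_closed _ _ (fun x : 'rV[R]_n => mxdot (x *m M) (x *m M))
      [set y | y = c]); last exact: closed_eq.
    by move=> x _; exact: continuous_mxdot_mulmx.
  by apply: closedI; exact: closed_level.
have [x0 [x0V x01]] := exists_unit_kernel V kn.
have A0 : A !=set0 by exists x0; split; rewrite /= ?x0V ?mulmx1// mxdot0l.
have [|x xA xmax] := EVT_max_rV
    (f := fun x : 'rV[R]_n => mxdot (x *m C^T) (x *m C^T)) A0 A_compact.
  exact/continuous_subspaceT/continuous_mxdot_mulmx.
move: xA; rewrite inE => -[/mxdot_eq0 xV /=]; rewrite mulmx1 => x1.
exists x^T; split.
- by rewrite -trmx_mul xV trmx0.
- by rewrite trdot.
- move=> y Vy; have [/mxdot_eq0 ->|y0] := eqVneq (mxdot y y) 0.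
    by rewrite mulmx0 !mxdot0l mulr0.
  have yp : 0 < mxdot y y by rewrite lt0r y0 mxdot_ge0.
  have := xmax ((Num.sqrt (mxdot y y))^-1 *: y^T); rewrite inE.
  rewrite -!scalemxAl !mxdotZl !mxdotZr !mulrA -invfM -expr2.
  rewrite sqr_sqrtr ?mxdot_ge0//.
  rewrite -!trmx_mul !trdot ler_pdivrMl//.
  have -> : mxdot (C *m x^T) (C *m x^T) = mxdot (x *m C^T) (x *m C^T).
    by rewrite -trdot trmx_mul trmxK.
  rewrite mulrC; apply; split=> /=; rewrite -scalemxAl mxdotZl mxdotZr.
    by rewrite -[V]trmxK -trmx_mul Vy trmx0 mxdot0l !mulr0.
  by rewrite mulmx1 trdot mulrA -invfM -expr2 sqr_sqrtr ?mxdot_ge0// mulVf.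
Qed.

Lemma mulmx_tr_orthonormal m k (U : 'M[R]_(m, k)) :
  k = m -> U^T *m U = 1%:M -> U *m U^T = 1%:M.
Proof. by move=> km; rewrite {}km in U *; exact: mulmx1C. Qed.

Lemma orthonormal_row_mx m k (U : 'M[R]_(m, k)) (y : 'cV[R]_m) :
  U^T *m U = 1%:M -> U^T *m y = 0 -> mxdot y y = 1 ->
  (row_mx U y)^T *m row_mx U y = 1%:M.
Proof.
move=> UU Uy yy; rewrite tr_row_mx mul_col_row UU Uy.
have -> : y^T *m U = 0 by rewrite -[U]trmxK -trmx_mul Uy trmx0.
by rewrite [y^T *m y]mx11_scalar -trace_mx11 -[\tr _]/(mxdot y y) yy
           -scalar_mx_block.
Qed.

(* Extends a partial decomposition by the direction [x] orthogonal to [V] that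
   [C] stretches most; by maximality [C x] and [C^T y] are then parallel to the
   new vectors [y] and [x]. *)
Lemma svd_prefix m n (C : 'M[R]_(m, n)) k : (k <= minn m n)%N ->
  exists (U : 'M[R]_(m, k)) (s : 'rV[R]_k) (V : 'M[R]_(n, k)),
    [/\ U^T *m U = 1%:M, V^T *m V = 1%:M,
        C *m V = U *m diag_mx s, C^T *m U = V *m diag_mx s &
    [/\ forall i, 0 <= s 0 i,
        forall i j : 'I_k, (i <= j)%N -> s 0 j <= s 0 i
      & forall (y : 'cV[R]_n) i, V^T *m y = 0 ->
          mxdot (C *m y) (C *m y) <= s 0 i ^+ 2 * mxdot y y]].
Proof.
elim: k => [_|k IHk kmn].
  exists (const_mx 0), 0, (const_mx 0).
  split; last by split=> [[]|[]|? []].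
  - by apply/matrixP => -[].
  - by apply/matrixP => -[].
  - by apply/matrixP => i [].
  - by apply/matrixP => i [].
have [U [s [V [UU VV CV CU [s0 s_decr s_max]]]]] := IHk (ltnW kmn).
move: kmn; rewrite leq_min => /andP[km kn].
have [x [Vx xx x_max]] := exists_unit_kernel_max C V kn.
pose sg := Num.sqrt (mxdot (C *m x) (C *m x)).
have sg0 : 0 <= sg := sqrtr_ge0 _.
have sgE : mxdot (C *m x) (C *m x) = sg ^+ 2 by rewrite sqr_sqrtr ?mxdot_ge0.
(* Transposing [CU] gives [U^T C = diag_mx s V^T], which vanishes on [x]. *)
have UCx : U^T *m (C *m x) = 0.
  by rewrite mulmxA -[U^T *m C]trmxK trmx_mul trmxK CU trmx_mul -mulmxA Vx
             mulmx0.
(* [y] is [C x] normalised; if [C x = 0], any unit vector orthogonal to [U] serves, and one exists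
   since [k < m]. *)
have [y [Uy yy Cx]] : exists y : 'cV[R]_m,
    [/\ U^T *m y = 0, mxdot y y = 1 & C *m x = sg *: y].
  have [sg_eq0|sg_neq0] := eqVneq sg 0.
    have [y [yU yy]] := exists_unit_kernel U km.
    exists y^T; split.
    - by rewrite -trmx_mul yU trmx0.
    - by rewrite /mxdot trmxK mxtrace_mulC -mxtrace_tr trmx_mul trmxK.
    - by rewrite sg_eq0 scale0r; apply: mxdot_eq0; rewrite sgE sg_eq0 expr0n.
  exists (sg^-1 *: (C *m x)); split.
  - by rewrite -scalemxAr UCx scaler0.
  - by rewrite mxdotZl mxdotZr sgE; field.
  - by rewrite scalerA mulfV// scale1r.
pose z := C^T *m y.
have Vz : V^T *m z = 0.
  by rewrite mulmxA -trmx_mul CV trmx_mul -mulmxA Uy mulmx0.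
have zx : mxdot z x = sg.
  by rewrite mxdot_mull trmxK Cx mxdotZr yy mulr1.
(* Cauchy-Schwarz and maximality give [|z|^4 = <C z, y>^2 <= |C z|^2 <= sg^2 |z|^2], so [|z| <= sg].
   Since [<z, x> = sg], it follows that [|z - sg x|^2 = |z|^2 - sg^2 <= 0]. *)
have zE : z = sg *: x.
  have CzN : mxdot (C *m z) y = mxdot z z by rewrite mxdot_mull.
  have z_le : mxdot z z <= sg ^+ 2.
    have := mxdot_ge0 (C *m z - mxdot z z *: y).
    rewrite mxdotDl !mxdotDr !mxdotNl !mxdotNr !mxdotZl !mxdotZr yy.
    rewrite (mxdotC y) CzN; have := x_max z Vz; rewrite sgE.
    have [->|z0] := eqVneq (mxdot z z) 0; first by rewrite sqr_ge0.
    have zp : 0 < mxdot z z by rewrite lt0r z0 mxdot_ge0.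
    move=> le1 le2; rewrite -(ler_pM2r zp); lra.
  apply/eqP; rewrite -subr_eq0; apply/eqP/mxdot_eq0/le_anti/andP; split.
    rewrite mxdotDl !mxdotDr !mxdotNl !mxdotNr !mxdotZl !mxdotZr xx.
    rewrite (mxdotC x) zx; lra.
  exact: mxdot_ge0.
rewrite -addn1; exists (row_mx U y), (row_mx s sg%:M), (row_mx V x); split.
- exact: orthonormal_row_mx.
- exact: orthonormal_row_mx.
- rewrite mul_mx_row CV Cx diag_mx_row mul_row_block !mulmx0 addr0 add0r.
  congr row_mx; apply/matrixP => i j.
  by rewrite mul_mx_diag !mxE !ord1 eqxx mulr1n mulrC.
- rewrite mul_mx_row CU -/z zE diag_mx_row mul_row_block !mulmx0 addr0 add0r.
  congr row_mx; apply/matrixP => i j.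
  by rewrite mul_mx_diag !mxE !ord1 eqxx mulr1n mulrC.
(* The earlier values bound the stretching on the whole complement of [V], where [x] lies; this
   keeps the sequence decreasing. *)
have sg_le i : sg <= s 0 i.
  have := s_max x i Vx; rewrite sgE xx mulr1 ler_sqr// nnegrE//.
split.
- move=> i; case: (split_ordP i) => j ->; rewrite ?row_mxEl ?row_mxEr//.
  by rewrite ord1 mxE eqxx.
- move=> i j; case: (split_ordP i) => i' ->; case: (split_ordP j) => j' ->;
    rewrite ?row_mxEl ?row_mxEr ?ord1 ?mxE ?eqxx ?mulr1n//=.
  + exact: s_decr.
  + by rewrite addn0 leqNgt ltn_ord.
- move=> v i; rewrite tr_row_mx mul_col_mx -[0]vsubmxK => /eq_col_mx[].
  rewrite !linear0 => Vv _.
  case: (split_ordP i) => j ->; rewrite ?row_mxEl ?row_mxEr ?s_max//.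
  by rewrite ord1 mxE eqxx -sgE x_max.
Qed.

Lemma svd_exists m n (C : 'M[R]_(m, n)) : exists U s V, is_svd C U s V.
Proof.
have [U [s [V [UU VV CV CU [s0 s_decr _]]]]] := svd_prefix C (leqnn _).
(* At full length one of [U], [V] is square, hence orthogonal, and cancels from [U U^T C] or from
   [C V V^T]. *)
exists U, s, V; split=> //; case/orP: (leq_total m n) => [mn|nm].
  rewrite -mulmxA -(tr_diag_mx s) -(trmx_mul V) -CU trmx_mul trmxK.
  by rewrite mulmxA mulmx_tr_orthonormal ?mul1mx//; exact/minn_idPl.
rewrite -CV -mulmxA mulmx_tr_orthonormal ?mulmx1//.
exact/minn_idPr.
Qed.

End SingularValueDecomposition.

(** * Systematic sampling at a given water level *)

Section SystematicSampling.
Variable R : realType.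
Implicit Types (sigma : nat -> R) (t theta : R).

Definition level sigma t i := Num.max (sigma i) t.

(* Equal to 0 when [level sigma t i = 0]. *)
Definition inclusion sigma t i := sigma i / level sigma t i.

Definition cumul sigma t i := \sum_(j < i) inclusion sigma t j.

(** At [t = 0] every nonzero [sigma i] has inclusion 1, and there may be fewer than [r] of these;
    only then may the sum stay below [r]. *)
Definition water_level sigma q r t : Prop :=
  [/\ 0 <= t, cumul sigma t q <= r%:R & t != 0 -> cumul sigma t q = r%:R].

(** For [theta] in [[0, 1)] this integer part counts the terms kept among the first [i]. *)
Definition hits sigma t theta i := Num.truncn (theta + cumul sigma t i).

Definition selected sigma t theta i : bool :=
  (hits sigma t theta i < hits sigma t theta i.+1)%N.

Definition weight sigma t theta i : R :=
  level sigma t i * (selected sigma t theta i)%:R.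

Section Sigma.
Variables (sigma : nat -> R) (t : R).
Hypotheses (sigma0 : forall i, 0 <= sigma i) (t0 : 0 <= t).

Lemma level_ge i : t <= level sigma t i.
Proof. by rewrite le_max lexx orbT. Qed.

Lemma level_ge0 i : 0 <= level sigma t i.
Proof. exact: le_trans (level_ge i). Qed.

Lemma inclusion_ge0 i : 0 <= inclusion sigma t i.
Proof. by rewrite divr_ge0 ?level_ge0. Qed.

(** When the level is 0 the quotient is 0 by convention, but then [sigma i], squeezed between 0 and
    the level, is 0 too. *)
Lemma level_inclusion i : level sigma t i * inclusion sigma t i = sigma i.
Proof.
have [l0|l0] := eqVneq (level sigma t i) 0; last by rewrite mulrC divfK.
by rewrite l0 mul0r; apply/le_anti; rewrite sigma0 -l0 le_max lexx.
Qed.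

Lemma inclusion_le1 i : inclusion sigma t i <= 1.
Proof.
have [l0|l0] := eqVneq (level sigma t i) 0.
  by rewrite /inclusion l0 invr0 mulr0.
by rewrite ler_pdivrMr ?mul1r ?le_max ?lexx// lt0r l0 level_ge0.
Qed.

Lemma inclusion_eq1 i : t < level sigma t i -> inclusion sigma t i = 1.
Proof.
rewrite lt_max ltxx orbF => ts.
rewrite /inclusion /level (max_idPl (ltW ts)) divff//.
by rewrite gt_eqF// (le_lt_trans t0).
Qed.

Lemma cumulS i : cumul sigma t i.+1 = cumul sigma t i + inclusion sigma t i.
Proof. by rewrite /cumul big_ord_recr. Qed.

Lemma cumul_ge0 i : 0 <= cumul sigma t i.
Proof. by rewrite sumr_ge0// => j _; exact: inclusion_ge0. Qed.

Lemma le_cumul : {homo cumul sigma t : i j / (i <= j)%N >-> i <= j}.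
Proof.
apply: homo_leq => [//||i]; first by move=> ? ? ?; exact: le_trans.
by rewrite cumulS lerDl inclusion_ge0.
Qed.

Variable theta : R.
Hypothesis theta01 : 0 <= theta < 1.

Lemma theta_cumul_ge0 i : 0 <= theta + cumul sigma t i.
Proof. by rewrite addr_ge0 ?cumul_ge0//; case/andP: theta01. Qed.

Lemma hits0 : hits sigma t theta 0 = 0%N.
Proof. by apply: truncn_def; rewrite /cumul big_ord0 addr0. Qed.

(** The sampling position advances by an inclusion in [[0, 1]], so its integer part grows by 0 or
    1. *)
Lemma hitsS i :
  hits sigma t theta i.+1 = (hits sigma t theta i + selected sigma t theta i)%N.
Proof.
suff : (hits sigma t theta i <= hits sigma t theta i.+1 <=
        (hits sigma t theta i).+1)%N.
  rewrite /selected => /andP[]; case: ltngtP => //.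
    by move=> + _; rewrite addn1 => /[swap] ? ?; apply/anti_leq/andP.
  by move=> ->; rewrite addn0.
apply/andP; split.
  by apply: le_truncn; rewrite lerD2l le_cumul.
rewrite truncn_le_nat cumulS addrA -addn1 natrD.
rewrite ltr_leD ?inclusion_le1//.
by have /andP[] := truncn_itv (theta_cumul_ge0 i).
Qed.

(** The form tested by the program, which keeps [hits] in a counter and never computes an integer
    part. *)
Lemma selectedE i : selected sigma t theta i =
  ((hits sigma t theta i).+1%:R <= theta + cumul sigma t i.+1).
Proof. by rewrite /selected truncn_ge_nat ?theta_cumul_ge0. Qed.

Lemma selected_inclusion1 i :
  inclusion sigma t i = 1 -> selected sigma t theta i.
Proof.
move=> p1; rewrite selectedE cumulS p1 addrA -addn1 natrD lerD2r.
by have /andP[] := truncn_itv (theta_cumul_ge0 i).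
Qed.

Lemma sum_selected q :
  (\sum_(i < q) selected sigma t theta i)%N = hits sigma t theta q.
Proof.
elim: q => [|q IHq]; first by rewrite big_ord0 hits0.
by rewrite big_ord_recr/= IHq hitsS.
Qed.

Lemma hits_le q r : cumul sigma t q <= r%:R -> (hits sigma t theta q <= r)%N.
Proof.
move=> Pr; rewrite truncn_le_nat -addn1 natrD addrC ler_ltD//.
by case/andP: theta01.
Qed.

Lemma hits_eq q r : cumul sigma t q = r%:R -> hits sigma t theta q = r.
Proof.
move=> Pr; apply: truncn_def; case/andP: theta01 => th0 th1.
by rewrite Pr -addn1 natrD lerDr th0 addrC ltrD2l.
Qed.

(** Turns the indicator into a difference of integer parts, whose means [has_mean_truncn]
    provides. *)
Lemma weightE i : weight sigma t theta i =
  level sigma t i *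
    ((hits sigma t theta i.+1)%:R - (hits sigma t theta i)%:R).
Proof. by rewrite hitsS natrD addrAC subrr add0r. Qed.

(* Indices above the water level are always selected, and exactly [r] indices
   are selected unless [t = 0]. *)
Lemma sum_sqr_level_selected q r : water_level sigma q r t ->
  \sum_(i < q) level sigma t i ^+ 2 * (selected sigma t theta i)%:R =
    \sum_(i < q) (level sigma t i ^+ 2 - t ^+ 2) + t ^+ 2 * r%:R.
Proof.
move=> [_ _ Pr].
have -> : t ^+ 2 * r%:R =
    \sum_(i < q) t ^+ 2 * (selected sigma t theta i)%:R.
  have [->|tN0] := eqVneq t 0.
    by rewrite expr0n mul0r big1// => i _; rewrite mul0r.
  by rewrite -mulr_sumr -natr_sum sum_selected (hits_eq (Pr tN0)).
rewrite -big_split; apply: eq_bigr => i _ /=.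
have := level_ge i; rewrite le_eqVlt => /orP[/eqP <-|/inclusion_eq1 p1].
  by rewrite subrr add0r.
by rewrite selected_inclusion1// !mulr1 subrK.
Qed.

End Sigma.
End SystematicSampling.

(** * Means of real random variables *)

Section Mean.
Context {R : realType} {d : measure_display} {T : measurableType d}.
Variable P : probability T R.
Implicit Types f g : T -> R.

(** Bundling integrability with the value makes means stable under linear combinations without side
    conditions. *)
Definition has_mean f (c : R) : Prop :=
  P.-integrable setT (EFin \o f) /\ (\int[P]_w (f w)%:E = c%:E)%E.

Lemma has_mean_cst c : has_mean (fun=> c) c.
Proof.
split; first exact: finite_measure_integrable_cst.
by rewrite integral_cst//= probability_setT mule1.
Qed.

Lemma has_meanD f g a b : has_mean f a -> has_mean g b ->
  has_mean (fun w => f w + g w) (a + b).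
Proof.
move=> [intf meanf] [intg meang]; split.
  exact: (integrableD measurableT intf intg).
under eq_integral do rewrite EFinD.
by rewrite integralD// meanf meang.
Qed.

Lemma has_meanZ k f a : has_mean f a -> has_mean (fun w => k * f w) (k * a).
Proof.
move=> [intf meanf]; split; first exact: (integrableZl measurableT k intf).
under eq_integral do rewrite EFinM.
by rewrite integralZl// meanf.
Qed.

Lemma has_mean_sum (I : Type) (s : seq I) (F : I -> T -> R) (a : I -> R) :
  (forall i, has_mean (F i) (a i)) ->
  has_mean (fun w => \sum_(i <- s) F i w) (\sum_(i <- s) a i).
Proof.
move=> mF; elim: s => [|i s IHs].
  by rewrite big_nil; under eq_fun do rewrite big_nil; exact: has_mean_cst.
by rewrite big_cons; under eq_fun do rewrite big_cons; exact: has_meanD.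
Qed.

Lemma has_mean_indic (A : set T) c : measurable A -> P A = c%:E ->
  has_mean (\1_A) c.
Proof.
move=> mA PA; split; first exact: integrable_indic.
by rewrite integral_indic// setIT.
Qed.

Lemma has_mean_measurable f c : has_mean f c -> measurable_fun setT f.
Proof. by case=> /integrableP[/measurable_EFinP]. Qed.

(** The chain is [E f <= E f^+ <= E g], the last step by [g >= 0]. The integral of [g] may be
    infinite, as for a competitor of infinite variance. *)
Lemma has_mean_le_integral f c (g : T -> R) : has_mean f c ->
  measurable_fun setT g -> (forall w, 0 <= g w) ->
  {ae P, forall w, f w <= g w} ->
  (c%:E <= \int[P]_w (g w)%:E)%E.
Proof.
move=> mf mg g0 fg; rewrite -(proj2 mf) integralE.
apply: (@le_trans _ _ (\int[P]_w ((EFin \o f)^\+ w))%E).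
  by apply: geeDl; rewrite oppe_le0 integral_ge0.
have mEf : measurable_fun setT (EFin \o f).
  exact/measurable_EFinP/(has_mean_measurable mf).
apply: ae_ge0_le_integral => //.
- exact: measurable_funepos.
- by move=> w _; rewrite lee_fin.
- exact/measurable_EFinP.
- apply: filterS fg => w fgw _; rewrite funeposE ge_max !lee_fin fgw.
  exact: g0.
Qed.

End Mean.

(** * The variance lower bound and the mean of randomised rounding *)

Section Optimality.
Context {R : realType}.

Lemma mxrank_sum_le m n (I : Type) (s : seq I) (A : I -> 'M[R]_(m, n)) :
  (\rank (\sum_(i <- s) A i)%R <= \sum_(i <- s) \rank (A i))%N.
Proof.
elim: s => [|i s IHs]; first by rewrite !big_nil mxrank0.
rewrite !big_cons (leq_trans (mxrankS (addmx_sub_adds (submx_refl (A i))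
  (submx_refl (\sum_(j <- s) A j)))))//.
by rewrite (leq_trans (mxrank_adds_leqif _ _).1)// leq_add2l.
Qed.

Lemma rank_diag_mx_le q (w : 'rV[R]_q) :
  (\rank (diag_mx w) <= \sum_i (w 0 i != 0)%R)%N.
Proof.
rewrite diag_mx_sum_delta (leq_trans (mxrank_sum_le _ _))//.
apply: leq_sum => i _; have [->|w0] := eqVneq (w 0 i) 0.
  by rewrite scale0r mxrank0.
by rewrite mxrank_scale_nz// mxrank_delta.
Qed.

Context {d : measure_display} {T : measurableType d} (P : probability T R).

Lemma unbiased_approximatorP m n (X : T -> 'M[R]_(m, n)) C :
  unbiased_approximator P X C <->
  forall i j, has_mean P (fun w => X w i j) (C i j).
Proof.
split=> [[_ intX EX] i j|meanX].
  split; first exact: intX.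
  rewrite -EX mxE fineK; rewrite expectation.unlock//.
  exact: integrable_fin_num (intX i j).
split=> [i j|i j|]; first exact: has_mean_measurable (meanX i j).
  by case: (meanX i j).
apply/matrixP => i j; rewrite mxE expectation.unlock.
by case: (meanX i j) => _ ->.
Qed.

Lemma has_mean_mxdot m n (X : T -> 'M[R]_(m, n)) C G :
  unbiased_approximator P X C ->
  has_mean P (fun w => mxdot (X w) G) (mxdot C G).
Proof.
move=> /unbiased_approximatorP meanX; rewrite mxdotE.
under eq_fun do rewrite mxdotE.
apply: has_mean_sum => i; apply: has_mean_sum => j; rewrite mulrC.
by under eq_fun do rewrite mulrC; exact: has_meanZ.
Qed.

Lemma mx_varianceE m n (X : T -> 'M[R]_(m, n)) C :
  unbiased_approximator P X C ->
  mx_variance P X = (\int[P]_w (mxdot (X w - C) (X w - C))%:E)%E.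
Proof.
move=> [_ _ EX]; rewrite /mx_variance EX.
by apply: eq_integral => w _; rewrite frobenius_norm_sqr.
Qed.

Lemma measurable_mxdot_sub m n (X : T -> 'M[R]_(m, n)) C :
  random_matrix X -> measurable_fun setT (fun w => mxdot (X w - C) (X w - C)).
Proof.
move=> mX; under eq_fun do rewrite mxdotE.
apply: measurable_sum => i; apply: measurable_sum => j.
have mE : measurable_fun setT (fun w => (X w - C) i j).
  under eq_fun do rewrite !mxE.
  by apply: measurable_funB => //; exact: mX.
exact: measurable_funM.
Qed.

Lemma mxdot_sub_sub m n (X C : 'M[R]_(m, n)) :
  mxdot (X - C) (X - C) = mxdot X X - 2 * mxdot X C + mxdot C C.
Proof.
rewrite mxdotDl !mxdotDr !mxdotNl !mxdotNr (mxdotC C X); ring.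
Qed.

(* The left-hand side is the mean of an affine minorant of [|Y - C|^2]. *)
Lemma variance_lower_bound m n q (U : 'M[R]_(m, q)) (V : 'M[R]_(n, q))
    (b : 'rV[R]_q) (t : R) (r : nat) (C : 'M[R]_(m, n))
    (Y : T -> 'M[R]_(m, n)) :
  U^T *m U = 1%:M -> V^T *m V = 1%:M -> 0 <= t -> (forall i, t <= b 0 i) ->
  unbiased_approximator P Y C ->
  {ae P, forall w, (\rank (Y w) <= r)%N} ->
  ((2 * mxdot C (U *m diag_mx b *m V^T - C) +
      (mxdot C C - (\sum_i (b 0 i ^+ 2 - t ^+ 2) + t ^+ 2 * r%:R)))%:E
    <= mx_variance P Y)%E.
Proof.
move=> UU VV t0 tb unbY rY; rewrite (mx_varianceE unbY).
set B := U *m _ *m _; set beta := \sum_i (b 0 i ^+ 2 - t ^+ 2) + _.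
apply: (has_mean_le_integral
  (f := fun w => 2 * mxdot (Y w) (B - C) + (mxdot C C - beta))).
- apply: has_meanD; last exact: has_mean_cst.
  by apply: has_meanZ; exact: has_mean_mxdot.
- by case: unbY => mY _ _; exact: measurable_mxdot_sub.
- by move=> w; exact: mxdot_ge0.
- apply: filterS rY => w rYw.
  have := low_rank_bound UU VV t0 tb rYw; rewrite -/B -/beta.
  rewrite mxdot_sub_sub mxdotDr mxdotNr; lra.
Qed.

Definition uniform_unit (theta : T -> R) : Prop :=
  [/\ measurable_fun setT theta, forall w, 0 <= theta w < 1
    & forall c, 0 < c <= 1 -> P [set w | c <= theta w] = (1 - c)%:E].

(** A uniform offset makes rounding down unbiased: the result is [N], or [N + 1] when [theta]
    reaches [c = 1 - (a - N)], which happens with probability [a - N]. *)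
Lemma has_mean_truncn theta a : uniform_unit theta -> 0 <= a ->
  has_mean P (fun w => (Num.truncn (theta w + a))%:R) a.
Proof.
move=> [mth th01 Pth] a0; have /andP[Na aN] := truncn_itv a0.
set N := Num.truncn a in Na aN; pose c := 1 - (a - N%:R).
have /andP[c0 c1] : 0 < c <= 1.
  by rewrite subr_gt0 ltrBlDl natr1 aN lerBlDr lerDl subr_ge0.
have -> : a = N%:R + (1 - c) by rewrite /c; ring.
have -> : (fun w => (Num.truncn (theta w + (N%:R + (1 - c))))%:R) =
          (fun w => N%:R + \1_[set w | c <= theta w] w) :> (T -> R).
  apply/funext => w; rewrite indicE; have /andP[th0 th1] := th01 w.
  have -> : (w \in [set w | c <= theta w]) = (c <= theta w).
    by apply/idP/idP; rewrite inE.
  rewrite -natrD; congr (_%:R); apply: truncn_def.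
  case: (leP c (theta w)) => [cth|thc]; rewrite ?addn0 ?addn1 -?natr1;
    apply/andP; split; lra.
apply: has_meanD; first exact: has_mean_cst.
apply: has_mean_indic; last by apply: Pth; rewrite c0.
rewrite -[X in measurable X]setTI.
rewrite (_ : [set w | _] = theta @^-1` `[c, +oo[).
  exact: mth.
by apply/seteqP; split=> w /=; rewrite in_itv/= andbT.
Qed.

End Optimality.

(** [X] attains the affine minorant of [variance_lower_bound] at every outcome, so its variance is
    the mean of that minorant, which is the same for all competitors. The rank is at most the number
    of selected terms. *)
Lemma systematic_sampling_optimal (R : realType) d (T : measurableType d)
    (P : probability T R) m n q (C : 'M[R]_(m, n)) (U : 'M[R]_(m, q))
    (V : 'M[R]_(n, q)) (sigma : nat -> R) (r : nat) (t : R) (theta : T -> R)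
    (X : T -> 'M[R]_(m, n)) :
  U^T *m U = 1%:M -> V^T *m V = 1%:M -> (forall i, 0 <= sigma i) ->
  C = U *m diag_mx (\row_i sigma i) *m V^T ->
  water_level sigma q r t -> uniform_unit P theta ->
  (forall w, X w = U *m diag_mx (\row_i weight sigma t (theta w) i) *m V^T) ->
  optimal_approximator P X C r.
Proof.
move=> UU VV s0 CE wl unif XE; have [t0 Pr _] := wl.
have th01 w : 0 <= theta w < 1 by case: unif.
have mxE' (x : nat -> R) i j :
    (U *m diag_mx (\row_(l < q) x l) *m V^T) i j =
    \sum_(l < q) U i l * V j l * x l.
  by rewrite mxE; apply: eq_bigr => l _; rewrite mul_mx_diag !mxE mulrAC.
have unbX : unbiased_approximator P X C.
  apply/unbiased_approximatorP => i j; rewrite CE mxE'.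
  under eq_fun do rewrite XE mxE'.
  apply: has_mean_sum => l; apply: has_meanZ; rewrite -(level_inclusion t s0 l).
  under eq_fun do rewrite weightE//.
  (* The mean of [weight] telescopes: [cumul] at [l.+1] minus [cumul] at [l], scaled by the
     level. *)
  have -> : inclusion sigma t l = cumul sigma t l.+1 + -1 * cumul sigma t l.
    by rewrite cumulS; ring.
  apply: has_meanZ; under eq_fun do rewrite -mulN1r.
  apply: has_meanD; first exact: has_mean_truncn unif (cumul_ge0 s0 t0 _).
  by apply: has_meanZ; exact: has_mean_truncn unif (cumul_ge0 s0 t0 _).
split=> // [w|d' T' P' Y unbY rY].
  rewrite XE (leq_trans (mxrankM_maxl _ _))// (leq_trans (mxrankM_maxr _ _))//.
  rewrite (leq_trans (rank_diag_mx_le _))//.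
  apply: leq_trans (hits_le (th01 w) Pr); rewrite -sum_selected//.
  apply: leq_sum => i _; rewrite mxE /weight.
  by case: selected; rewrite ?mulr0 ?eqxx// leq_b1.
pose b : 'rV[R]_q := \row_i level sigma t i.
have tb i : t <= b 0 i by rewrite mxE level_ge.
have := variance_lower_bound UU VV t0 tb unbY rY; apply: le_trans.
rewrite (mx_varianceE unbX) le_eqVlt; apply/orP; left; apply/eqP.
set B := U *m _ *m _; set beta := \sum_i (b 0 i ^+ 2 - t ^+ 2) + _.
have -> : (fun w => (mxdot (X w - C) (X w - C))%:E) =
          (fun w => (2 * mxdot (X w) (B - C) + (mxdot C C - beta))%:E).
  apply/funext => w; congr (_%:E); rewrite mxdot_sub_sub mxdotDr mxdotNr.
  have betaE : beta =
      \sum_(i < q) level sigma t i ^+ 2 * (selected sigma t (theta w) i)%:R.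
    rewrite (sum_sqr_level_selected s0 t0 (th01 w) wl); congr (_ + _).
    by apply: eq_bigr => i _; rewrite mxE.
  (* Each weight is 0 or the level itself, so [weight ^ 2] and [weight * level] agree. *)
  have XX : mxdot (X w) (X w) = beta.
    rewrite XE mxdot_svd// betaE.
    apply: eq_bigr => i _; rewrite !mxE /weight.
    by case: selected; rewrite ?mulr1 ?mulr0 ?mul0r -?expr2.
  have XB : mxdot (X w) B = beta.
    rewrite XE mxdot_svd// betaE.
    apply: eq_bigr => i _; rewrite !mxE /weight.
    by case: selected; rewrite ?mulr1 ?mulr0 ?mul0r -?expr2.
  by rewrite XX XB; ring.
apply: (proj2 (has_meanD (f := fun w => 2 * _) _ _)); last exact: has_mean_cst.
by apply: has_meanZ; exact: has_mean_mxdot.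
Qed.

(** * Search for the water level *)

Section WaterLevelSearch.
Variables (R : realType) (sigma : nat -> R) (q r : nat).
Hypothesis sigma0 : forall i, 0 <= sigma i.
Hypotheses (r_gt0 : (0 < r)%N) (rq : (r <= q)%N).
Hypothesis sigma_decr : forall i j, (i <= j)%N -> sigma j <= sigma i.

(** The comparison [sigma k <= S / (r - k)] of the next value with the candidate level, cleared of
    the division. *)
Definition stops k (S : R) : bool := (r - k)%:R * sigma k <= S.

(** The third clause puts the first [k] values above the candidate level. At [step = r] the last
    clause, with [k < r], forces the search to have stopped. *)
Definition search_inv step k (S : R) : Prop :=
  [/\ (k < r)%N, S = \sum_(k <= j < q) sigma j,
      forall i, (i < k)%N -> S < (r - k)%:R * sigma i
    & stops k S || (step <= k)%N].

Lemma search_inv0 : search_inv 0 0 (\sum_(j < q) sigma j).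
Proof. by split; rewrite ?orbT// big_mkord. Qed.

Lemma search_invS step k S : search_inv step k S ->
  if stops k S then search_inv step.+1 k S
  else search_inv step.+1 k.+1 (S - sigma k).
Proof.
move=> [kr SE head stop]; case: ifPn => [kS|]; first by split; rewrite ?kS.
move=> kS; move: stop; rewrite (negbTE kS) /= => step_k.
move: kS; rewrite /stops -ltNge => kS.
have kq : (k < q)%N := leq_trans kr rq.
have SE' : S - sigma k = \sum_(k.+1 <= j < q) sigma j.
  by rewrite SE big_ltn// addrC addKr.
have Sk0 : 0 <= S - sigma k by rewrite SE' sumr_ge0.
have rk : (r - k = (r - k.+1).+1)%N by rewrite subnSK.
have S_lt : S - sigma k < (r - k.+1)%:R * sigma k.
  by move: kS; rewrite rk -natr1 mulrDl mul1r; lra.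
split=> //.
(* With [r = k + 1] the right side of [S_lt] would be 0, below a nonnegative tail sum. *)
- rewrite -subn_gt0 lt0n; apply: contraTneq S_lt => ->.
  by rewrite mul0r -leNgt.
- move=> i; rewrite ltnS => ik; apply: (lt_le_trans S_lt).
  by rewrite ler_wpM2l// sigma_decr.
- by rewrite ltnS step_k orbT.
Qed.

(** The first [k] inclusions are 1 and the others are [sigma i / t]; they add up to [k + S / t],
    that is to [r] when [t] is nonzero. *)
Lemma search_water_level k S : search_inv r k S ->
  water_level sigma q r (S / (r - k)%:R).
Proof.
move=> [kr SE head stop]; set t := S / _.
have {stop} stop : stops k S by move: stop; rewrite (leqNgt r) kr orbF.
have rk0 : 0 < (r - k)%:R :> R by rewrite ltr0n subn_gt0.
have tE : S = (r - k)%:R * t by rewrite /t mulrC divfK// gt_eqF.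
have S0 : 0 <= S by rewrite SE sumr_ge0.
have t0 : 0 <= t by rewrite divr_ge0// ltW.
have headE i : (i < k)%N -> inclusion sigma t i = 1.
  move=> ik; apply: inclusion_eq1 => //; rewrite lt_max; apply/orP; left.
  by have := head i ik; rewrite tE ltr_pM2l.
have tailE i : (k <= i)%N -> inclusion sigma t i = sigma i / t.
  move=> ki; rewrite /inclusion /level; congr (_ / _); apply/max_idPr.
  apply: le_trans (sigma_decr ki) _.
  by move: stop; rewrite /stops tE ler_pM2l.
have cumulE : cumul sigma t q = k%:R + S / t.
  rewrite /cumul -(big_mkord xpredT (inclusion sigma t)).
  have kq := ltnW (leq_trans kr rq).
  rewrite (@big_cat_nat _ _ _ k)//=; congr (_ + _).
    rewrite -[in RHS](subn0 k) -sumr_const_nat.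
    by apply: eq_big_nat => i /andP[_]; exact: headE.
  by rewrite SE mulr_suml; apply: eq_big_nat => i /andP[ki _]; exact: tailE.
have cumul_t : t != 0 -> cumul sigma t q = r%:R.
  by move=> tN0; rewrite cumulE tE mulfK// -natrD subnKC// ltnW.
(* At [t = 0] the quotient [S / t] is 0 by convention, leaving the sum [k]. *)
split=> //; have [tE0|/cumul_t -> //] := eqVneq t 0.
by rewrite cumulE tE0 invr0 mulr0 addr0 ler_nat ltnW.
Qed.

Lemma water_level_exists : exists t, water_level sigma q r t.
Proof.
suff /(_ r)[k [S /search_water_level wl]] :
  forall step, exists k S, search_inv step k S by eexists; exact: wl.
elim=> [|step [k [S /search_invS]]]; first by do 2 eexists; exact: search_inv0.
by case: ifP => _ inv; do 2 eexists; exact: inv.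
Qed.

End WaterLevelSearch.

(** * Uniform draws forced into [[0, 1)] *)

Section UnitClamp.
Variable R : realType.

(** A uniform draw lies in [[0, 1)] only almost surely, whereas the rank bound must hold at every
    outcome; stray values are sent to 0. *)
Definition unit_clamp (x : R) : R := if 0 <= x < 1 then x else 0.

Lemma uniform_prob_co c : 0 < c <= 1 ->
  uniform_prob (@ltr01 R) `[c, 1[%classic = (1 - c)%:E.
Proof.
move=> /andP[c0 c1]; rewrite /uniform_prob.
under eq_integral => x.
  rewrite inE/= in_itv/= => /andP[cx x1].
  rewrite /uniform_pdf (ltW x1) (le_trans (ltW c0) cx)/= subr0 invr1; over.
rewrite integral_cst//= mul1e lebesgue_measure_itv/= lte_fin.
case: ltP => [_|c1']; first by rewrite EFinB.
have -> : c = 1 by apply/le_anti/andP.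
by rewrite subrr.
Qed.

(** For [0 < c] the clamped draw reaches [c] exactly when the draw lies in [[c, 1[], as stray values
    drop to 0. *)
Lemma uniform_unit_clamp d (T : measurableType d) (P : probability T R)
    (f : T -> R) : measurable_fun setT f ->
  (forall A, measurable A -> P (f @^-1` A) = uniform_prob (@ltr01 R) A) ->
  uniform_unit P (fun w => unit_clamp (f w)).
Proof.
move=> mf Pf; split.
- apply: measurable_fun_ifT => //.
  by apply: measurable_and;
    [exact: measurable_fun_ler|exact: measurable_fun_ltr].
- by move=> w; rewrite /unit_clamp; case: ifP; rewrite ?lexx ?ltr01.
- move=> c c01; rewrite -uniform_prob_co// -Pf//; congr (P _).
  case/andP: c01 => c0 c1; apply/seteqP; split=> w /=; rewrite in_itv/=.
    rewrite /unit_clamp; case: ifP => [/andP[_ ->] ->//|_].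
    by rewrite leNgt c0.
  by move=> /andP[cw w1]; rewrite /unit_clamp w1 (le_trans (ltW c0) cw).
Qed.

End UnitClamp.

(** * The programs *)

(* Register 3 holds [minn m n], 4 the number of singular values above the water
   level, 7 the number of selected terms, and 5, 6, 8 are loop counters.
   Arrays 3, 4, 5 hold the decomposition, 1 and 2 the two factors and 7 their
   product.  In row 0 of array 6, cell 0 holds a tail sum of singular values and
   then the water level, cell 1 the sampling position and cell 2 the current
   value of [level]. *)
Section Programs.

Let c0 := NConst 0.
Let c1 := NConst 1.
Let c2 := NConst 2.

Definition svd_and_rank : program :=
  Seq (Svd 0 3 4 5 (NReg 0) (NReg 1))
      (If (NLe (NReg 0) (NReg 1)) (SetN 3 (NReg 0)) (SetN 3 (NReg 1))).

Definition sum_singular_values : program :=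
  For 5 (NReg 3)
    (SetR 6 c0 c0 (RAdd (RCell 6 c0 c0) (RCell 4 c0 (NReg 5)))).

(** Loops have no exit: once the stopping test holds, the state it reads no longer changes and the
    remaining iterations idle. *)
Definition water_level_loop : program :=
  For 5 (NReg 2)
    (If (RLe (RMul (RNat (NSub (NReg 2) (NReg 4))) (RCell 4 c0 (NReg 4)))
             (RCell 6 c0 c0))
        Skip
        (Seq (SetR 6 c0 c0 (RSub (RCell 6 c0 c0) (RCell 4 c0 (NReg 4))))
             (SetN 4 (NAdd (NReg 4) c1)))).

Definition set_level_and_draw : program :=
  Seq (SetR 6 c0 c0 (RDiv (RCell 6 c0 c0) (RNat (NSub (NReg 2) (NReg 4)))))
  (Seq (Draw 6 c0 c1)
  (If (RLe (RNat c0) (RCell 6 c0 c1))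
      (If (RLe (RNat c1) (RCell 6 c0 c1)) (SetR 6 c0 c1 (RNat c0)) Skip)
      (SetR 6 c0 c1 (RNat c0)))).

Definition append_component : program :=
  Seq (For 6 (NReg 0)
        (SetR 1 (NReg 6) (NReg 7)
          (RMul (RCell 6 c0 c2) (RCell 3 (NReg 6) (NReg 5)))))
  (Seq (For 6 (NReg 1) (SetR 2 (NReg 7) (NReg 6) (RCell 5 (NReg 6) (NReg 5))))
       (SetN 7 (NAdd (NReg 7) c1))).

Definition pick_level : program :=
  If (RLe (RCell 4 c0 (NReg 5)) (RCell 6 c0 c0))
     (SetR 6 c0 c2 (RCell 6 c0 c0))
     (SetR 6 c0 c2 (RCell 4 c0 (NReg 5))).

Definition advance_position : program :=
  SetR 6 c0 c1
    (RAdd (RCell 6 c0 c1) (RDiv (RCell 4 c0 (NReg 5)) (RCell 6 c0 c2))).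

Definition select_component : program :=
  If (RLe (RNat (NAdd (NReg 7) c1)) (RCell 6 c0 c1)) append_component Skip.

Definition sample_components : program :=
  For 5 (NReg 3) (Seq pick_level (Seq advance_position select_component)).

Definition level_search : program :=
  Seq svd_and_rank (Seq sum_singular_values water_level_loop).

Definition factored_program : program :=
  Seq level_search (Seq set_level_and_draw sample_components).

(** Array 1 is still read as a factor, so the product accumulates in array 7, zero until then, and
    is copied afterwards. *)
Definition multiply_factors : program :=
  For 5 (NReg 0) (For 6 (NReg 1) (For 8 (NReg 2)
    (SetR 7 (NReg 5) (NReg 6)
      (RAdd (RCell 7 (NReg 5) (NReg 6))
            (RMul (RCell 1 (NReg 5) (NReg 8)) (RCell 2 (NReg 8) (NReg 6))))))).

Definition copy_product : program :=
  For 5 (NReg 0) (For 6 (NReg 1)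
    (SetR 1 (NReg 5) (NReg 6) (RCell 7 (NReg 5) (NReg 6)))).

Definition explicit_program : program :=
  Seq factored_program (Seq multiply_factors copy_product).

End Programs.

(** * Effect and running time of each phase *)

Section Execution.
Variables (R : realType) (svd : svd_solver R) (svd_time : nat -> nat -> nat).
Variable tape : nat -> R.

Local Notation exec := (exec svd svd_time tape).

Lemma exec_Seq c1 c2 (st : state R) :
  exec (Seq c1 c2) st = exec c2 (exec c1 st).
Proof. by []. Qed.

(** The invariant rule for loops; the bound is evaluated once, on entry. *)
Lemma exec_For (I : nat -> state R -> Prop) x e c (st : state R) :
  I 0%N (tick 1 st) ->
  (forall i st', (i < nat_eval st e)%N -> I i st' ->
     I i.+1 (exec c (tick 1 (set_reg x i st')))) ->
  I (nat_eval st e) (exec (For x e c) st).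
Proof.
move=> I0 /=; move: (nat_eval st e) => N; elim: N => [//|k IHk] IS.
rewrite iteriS; apply: (IS) => //; apply: IHk => i st' ik; apply: IS.
exact: ltnW.
Qed.

Lemma array_of_mxE m n (A : 'M[R]_(m, n)) (i : 'I_m) (j : 'I_n) :
  array_of_mx A i j = A i j.
Proof. by rewrite /array_of_mx !valK. Qed.

Lemma array_of_mxK m n (A : 'M[R]_(m, n)) : mx_of_array m n (array_of_mx A) = A.
Proof. by apply/matrixP => i j; rewrite mxE array_of_mxE. Qed.

(** [level_search] contains no [Draw], so both sides compute to the same state. *)
Lemma level_search_tape tape' (st : state R) :
  exec level_search st = Defs.exec svd svd_time tape' level_search st.
Proof. by []. Qed.

Section Phases.
Variables (m n r : nat) (U V : nat -> nat -> R) (sigma : nat -> R).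
Let q := minn m n.

Definition env k (st : state R) : Prop :=
  [/\ reg st 0 = m, reg st 1 = n, reg st 2 = r, reg st 3 = q & reg st 4 = k] /\
  [/\ arr st 3 = U, forall i, arr st 4 0 i = sigma i, arr st 5 = V
    & arr st 7 = fun _ _ => 0].

Definition fresh (st : state R) : Prop :=
  [/\ reg st 7 = 0%N, arr st 1 = fun _ _ => 0 & draws st = 0%N].

Lemma sum_singular_valuesP st :
  env 0 st -> fresh st -> arr st 6 0 0 = 0 ->
  let st' := exec sum_singular_values st in
  [/\ env 0 st', fresh st', arr st' 6 0 0 = \sum_(j < q) sigma j
    & (time st' = time st + 1 + q * 2)%N].
Proof.
move=> Est Fst S0 st'; have <- : nat_eval st (NReg 3) = q by case: Est => -[].
apply: (exec_For (I := fun i st' => [/\ env 0 st', fresh st',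
  arr st' 6 0 0 = \sum_(j < i) sigma j & (time st' = time st + 1 + i * 2)%N])).
  by rewrite big_ord0; split=> //=; lia.
move=> i st1 _ [[[? ? ? ? ?] [? h4 ? ?]] [? ? ?] h6 ht].
split=> //=; first by rewrite h6 h4 big_ord_recr.
by rewrite ht; lia.
Qed.

Lemma water_level_loopP st :
  (0 < r <= q)%N -> (forall i, 0 <= sigma i) ->
  (forall i j, (i <= j)%N -> sigma j <= sigma i) ->
  env 0 st -> fresh st -> arr st 6 0 0 = \sum_(j < q) sigma j ->
  let st' := exec water_level_loop st in
  exists k, [/\ env k st', fresh st', search_inv sigma q r r k (arr st' 6 0 0)
    & (time st' <= time st + 1 + r * 4)%N].
Proof.
move=> /andP[r_gt0 r_le] sigma0 sigma_decr Est Fst S0 st'.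
have rE : nat_eval st (NReg 2) = r by case: Est => -[].
have := (@exec_For (fun i st' => exists k, [/\ env k st', fresh st',
  search_inv sigma q r i k (arr st' 6 0 0)
  & (time st' <= time st + 1 + i * 4)%N]) 5 (NReg 2)).
rewrite -[in X in X -> _]/st' => /(_ _ st); rewrite rE; apply.
  exists 0%N; split=> //=; last by lia.
  by rewrite S0; exact: search_inv0.
move=> i st1 _ [k [[[h0 h1 h2 h3 h4] [? hs ? ?]] [? ? ?] inv ht]] /=.
have := search_invS sigma0 r_le sigma_decr inv; rewrite /stops h2 h4 hs.
case: ifP => _ inv'.
  by exists k; split=> //=; lia.
exists k.+1; split=> //=; try lia.
by split; split=> //=; rewrite addn1.
Qed.

Lemma set_level_and_drawP k st : env k st -> fresh st ->
  search_inv sigma q r r k (arr st 6 0 0) ->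
  let st' := exec set_level_and_draw st in
  [/\ env k st', reg st' 7 = 0%N /\ arr st' 1 = (fun _ _ => 0),
    arr st' 6 0 0 = arr st 6 0 0 / (r - k)%:R,
    arr st' 6 0 1 = unit_clamp (tape 0)
    & (time st' <= time st + 6)%N].
Proof.
move=> [[h0 h1 h2 h3 h4] [? hs ? ?]] [? ? hd] inv /=.
rewrite h2 h4 hd /unit_clamp (leNgt 1).
by case: (0 <= tape 0); case: (tape 0 < 1); split=> //=; lia.
Qed.

Lemma append_componentP k st : env k st ->
  let st' := exec append_component st in
  let i := reg st 5 in let cnt := reg st 7 in
  [/\ env k st',
    [/\ reg st' 7 = cnt.+1, arr st' 6 = arr st 6
      & arr st' 1 = fun a l => if (l == cnt) && (a < m)%N
                               then arr st 6 0 2 * U a i else arr st 1 a l],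
    arr st' 2 = (fun l b => if (l == cnt) && (b < n)%N
                            then V b i else arr st 2 l b)
    & (time st' = time st + 3 + m * 2 + n * 2)%N].
Proof.
move=> Est st' i cnt.
have mE : nat_eval st (NReg 0) = m by case: Est => -[].
rewrite {}/st' /append_component.
set loop1 := For 6 (NReg 0) _; set loop2 := For 6 (NReg 1) _.
pose st1 := exec loop1 st; pose st2 := exec loop2 st1.
have [E1 [i1 cnt1 S1 B1] A1 t1] : [/\ env k st1,
    [/\ reg st1 5 = i, reg st1 7 = cnt, arr st1 6 = arr st 6
      & arr st1 2 = arr st 2],
    arr st1 1 = (fun a l => if (l == cnt) && (a < m)%N
                            then arr st 6 0 2 * U a i else arr st 1 a l)
    & (time st1 = time st + 1 + m * 2)%N].
  rewrite -mE; apply: (exec_For (I := fun j st' => [/\ env k st',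
    [/\ reg st' 5 = i, reg st' 7 = cnt, arr st' 6 = arr st 6
      & arr st' 2 = arr st 2],
    arr st' 1 = (fun a l => if (l == cnt) && (a < j)%N
                            then arr st 6 0 2 * U a i else arr st 1 a l)
    & (time st' = time st + 1 + j * 2)%N])).
    split=> //=; last by lia.
    by apply/funext => a; apply/funext => l; rewrite andbF.
  move=> j st3 _ [[[? ? ? ? ?] [hU ? ? ?]] [h5 h7 h6 ?] h1 ht].
  split=> //=; last by lia.
  apply/funext => a; apply/funext => l; rewrite h1 h7 hU h5 h6.
  rewrite ltnS (leq_eqVlt a); case: (l == cnt); rewrite ?andbF ?andbT//=.
  by case: eqP => [->|].
have nE : nat_eval st1 (NReg 1) = n by case: E1 => -[].
have [E2 [i2 cnt2 S2 A2] B2 t2] : [/\ env k st2,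
    [/\ reg st2 5 = i, reg st2 7 = cnt, arr st2 6 = arr st 6
      & arr st2 1 = arr st1 1],
    arr st2 2 = (fun l b => if (l == cnt) && (b < n)%N
                            then V b i else arr st 2 l b)
    & (time st2 = time st1 + 1 + n * 2)%N].
  rewrite -nE; apply: (exec_For (I := fun j st' => [/\ env k st',
    [/\ reg st' 5 = i, reg st' 7 = cnt, arr st' 6 = arr st 6
      & arr st' 1 = arr st1 1],
    arr st' 2 = (fun l b => if (l == cnt) && (b < j)%N
                            then V b i else arr st 2 l b)
    & (time st' = time st1 + 1 + j * 2)%N])).
    split=> //=; last by lia.
    by apply/funext => a; apply/funext => l; rewrite andbF B1.
  move=> j st3 _ [[[? ? ? ? ?] [? ? hV ?]] [h5 h7 h6 ?] h2 ht].
  split=> //=; last by lia.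
  apply/funext => l; apply/funext => b; rewrite h2 h7 hV h5.
  rewrite ltnS (leq_eqVlt b); case: (l == cnt) => //=.
  by case: eqP => [->|].
have -> : exec (Seq loop1 (Seq loop2 (SetN 7 (NAdd (NReg 7) (NConst 1))))) st =
  exec (SetN 7 (NAdd (NReg 7) (NConst 1))) st2 by [].
case: E2 => -[? ? ? ? ?] [? ? ? ?].
by split=> //=; [split=> //=; [rewrite cnt2 addn1|rewrite A2]|lia].
Qed.

(** Unfilled columns of array 1 are zero, so the product over all [r] indices sees only the appended
    terms, whatever array 2 holds there. The 8 counts the single steps of one iteration that
    appends. *)
Definition sampling_inv t theta T0 i (st : state R) : Prop :=
  [/\ [/\ arr st 6 0 0 = t, arr st 6 0 1 = theta + cumul sigma t i
      & reg st 7 = hits sigma t theta i],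
    forall a l, (hits sigma t theta i <= l)%N -> arr st 1 a l = 0,
    forall a b, (a < m)%N -> (b < n)%N ->
      \sum_(l < r) arr st 1 a l * arr st 2 l b =
      \sum_(j < i) weight sigma t theta j * (U a j * V b j)
    & (time st <= T0 + i * (8 + m * 2 + n * 2))%N].

Lemma sample_componentsP k t st :
  (forall i, 0 <= sigma i) -> env k st -> reg st 7 = 0%N ->
  arr st 1 = (fun _ _ => 0) -> water_level sigma q r t -> arr st 6 0 0 = t ->
  0 <= arr st 6 0 1 < 1 ->
  let st' := exec sample_components st in
  env k st' /\ sampling_inv t (arr st 6 0 1) (time st + 1) q st'.
Proof.
move=> sigma0 Est h70 h10 wl tE th01 st'; set theta := arr st 6 0 1.
have [t0 Pr _] := wl.
have qE : nat_eval st (NReg 3) = q by case: Est => -[].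
rewrite -qE; apply: (exec_For (I := fun i st' =>
  env k st' /\ sampling_inv t theta (time st + 1) i st')).
  split=> //; split=> //=.
  - by split=> //=; rewrite ?h70 ?hits0// /cumul big_ord0 addr0.
  - by move=> a l _; rewrite h10.
  - by move=> a b _ _; rewrite big_ord0 big1// => l _; rewrite h10 mul0r.
  - by lia.
move=> i st1; rewrite qE => iq.
move=> [E1 [[ht hth hcnt] hA hAB htime]].
have [hreg [hU hs hV h7]] := E1.
pose lev := level sigma t i.
pose th' := theta + cumul sigma t i.+1.
pose st2 := tick 1 (set_cell 6 0 1 th'
  (tick 1 (set_cell 6 0 2 lev (tick 1 (tick 1 (set_reg 5 i st1)))))).
have -> : exec (Seq pick_level (Seq advance_position select_component))
      (tick 1 (set_reg 5 i st1)) =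
    if selected sigma t theta i then exec append_component (tick 1 st2)
    else tick 1 st2.
  have levelE : exec pick_level (tick 1 (set_reg 5 i st1)) =
      tick 1 (set_cell 6 0 2 lev (tick 1 (tick 1 (set_reg 5 i st1)))).
    by rewrite /= hs ht /lev /level maxEle; case: ifP.
  have advanceE : exec advance_position
      (tick 1 (set_cell 6 0 2 lev (tick 1 (tick 1 (set_reg 5 i st1))))) = st2.
    by rewrite /= hs hth -addrA -cumulS.
  rewrite -[LHS]/(exec select_component (exec advance_position
                    (exec pick_level (tick 1 (set_reg 5 i st1))))).
  rewrite levelE advanceE selectedE// -hcnt -(addn1 (reg st1 7)) -/th'.
  by [].
have E3 : env k (tick 1 st2) by [].
case: ifPn => sel; last first.
  split=> //; split=> /=; rewrite ?hitsS// ?(negbTE sel) ?addn0//.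
  - move=> a b am bn; rewrite big_ord_recr/= hAB//.
    by rewrite /weight (negbTE sel) mulr0 mul0r addr0.
  - by rewrite mulSn; lia.
have [E4 [h4 S4 A4] B4 t4] := append_componentP E3.
split=> //; have cntS : hits sigma t theta i.+1 = (hits sigma t theta i).+1.
  by rewrite hitsS// sel addn1.
(* The column about to be filled is one of the [r] columns of the output. *)
have cnt_r : (hits sigma t theta i < r)%N.
  rewrite -cntS; apply: hits_le => //; apply: le_trans Pr.
  exact: le_cumul.
split.
- by rewrite S4 h4 cntS /= ht hcnt.
- move=> a l; rewrite cntS => cl; rewrite A4 /= hcnt gtn_eqF//= hA//.
  exact: ltnW.
- move=> a b am bn; rewrite big_ord_recr/= -hAB// A4 B4 /= hcnt.
  rewrite (bigD1 (Ordinal cnt_r))//= [in RHS](bigD1 (Ordinal cnt_r))//=.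
  rewrite eqxx am bn hA// mul0r add0r addrC; congr (_ + _).
    apply: eq_bigr => l lc.
    suff /negbTE -> : val l != hits sigma t theta i by [].
    by apply: contra lc => /eqP lE; apply/eqP/val_inj.
  by rewrite /weight sel mulr1 mulrA.
- rewrite t4 /= mulSn; lia.
Qed.

Lemma multiply_factorsP k st : env k st ->
  let st' := exec multiply_factors st in
  [/\ [/\ reg st' 0 = m, reg st' 1 = n & reg st' 2 = r],
    arr st' 7 = (fun a b =>
      if (a < m)%N && (b < n)%N
      then \sum_(l < r) arr st 1 a l * arr st 2 l b else 0)
    & (time st' = time st + 1 + m * (2 + n * (2 + r * 2)))%N].
Proof.
move=> [[m0 n0 r0 _ _] [_ _ _ h70]] st'.
pose prod a b := \sum_(l < r) arr st 1 a l * arr st 2 l b.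
pose keep st1 := [/\ reg st1 0 = m, reg st1 1 = n, reg st1 2 = r,
  arr st1 1 = arr st 1 & arr st1 2 = arr st 2].
(* One invariant per nested loop: finished rows, finished entries of row [i] ([entry_inv]), partial
   sum of entry [(i, j)] ([term_inv]). *)
pose row_inv i st1 := [/\ keep st1,
  arr st1 7 = (fun a b => if (a < i)%N && (b < n)%N then prod a b else 0)
  & (time st1 = time st + 1 + i * (2 + n * (2 + r * 2)))%N].
suff : row_inv m st' by move=> [[]].
have mE : nat_eval st (NReg 0) = m by [].
rewrite -{1}mE; apply: exec_For.
  by split=> //=; lia.
move=> i st1 _ [[m1 n1 r1 A1 B1] h71 t1].
set st2 := tick 1 _.
pose entry_inv j st3 := [/\ keep st3, reg st3 5 = i,
  arr st3 7 = (fun a b => if (a < i)%N && (b < n)%N || (a == i) && (b < j)%N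
                          then prod a b else 0)
  & (time st3 = time st2 + 1 + j * (2 + r * 2))%N].
have nE : nat_eval st2 (NReg 1) = n by [].
set st3 := exec _ _; suff [K3 _ h73 t3] : entry_inv n st3.
  split=> //; last by rewrite t3 /= t1 mulSn; lia.
  rewrite h73; apply/funext => a; apply/funext => b.
  by rewrite -andb_orl orbC -leq_eqVlt -ltnS.
rewrite -{1}nE; apply: exec_For.
  split=> //=; last by lia.
  by rewrite h71; apply/funext => a; apply/funext => b; rewrite andbF orbF.
move=> j st4 _ [[m4 n4 r4 A4 B4] i4 h74 t4].
set st5 := tick 1 _.
have rE : nat_eval st5 (NReg 2) = r by [].
pose term_inv l st6 := [/\ keep st6, reg st6 5 = i, reg st6 6 = j,
  arr st6 7 = (fun a b => if (a == i) && (b == j)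
    then \sum_(l' < l) arr st 1 i l' * arr st 2 l' j else arr st4 7 a b)
  & (time st6 = time st5 + 1 + l * 2)%N].
set st6 := exec _ _; suff [K6 i6 _ h76 t6] : term_inv r st6.
  split=> //; last by rewrite t6 [time st5]/= t4 mulSn; lia.
  rewrite h76 h74; apply/funext => a; apply/funext => b.
  rewrite ltnS (leq_eqVlt b); case: eqP => [->|_] /=; last by rewrite !orbF.
  by case: eqP => [->|_] //=; rewrite orbT.
rewrite -{1}rE; apply: exec_For.
  split=> //=; last by lia.
  rewrite h74; apply/funext => a; apply/funext => b; rewrite big_ord0.
  case: (a =P i) => [->|//]; case: (b =P j) => [->|//].
  by rewrite /= !ltnn ?eqxx.
move=> l st7 _ [[m7 n7 r7 A7 B7] i7 j7 h77 t7].
split=> //=; last by rewrite t7 /=; lia.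
rewrite i7 j7 h77 A7 B7 !eqxx; apply/funext => a; apply/funext => b.
by rewrite [in RHS]big_ord_recr; case: ((a == i) && (b == j)) => /=.
Qed.

Lemma copy_productP st : reg st 0 = m -> reg st 1 = n ->
  let st' := exec copy_product st in
  arr st' 1 = (fun a b => if (a < m)%N && (b < n)%N
                          then arr st 7 a b else arr st 1 a b) /\
  (time st' = time st + 1 + m * (2 + n * 2))%N.
Proof.
move=> m0 n0 st'.
pose keep st1 := [/\ reg st1 0 = m, reg st1 1 = n & arr st1 7 = arr st 7].
pose row_inv i st1 := [/\ keep st1,
  arr st1 1 = (fun a b => if (a < i)%N && (b < n)%N
                          then arr st 7 a b else arr st 1 a b)
  & (time st1 = time st + 1 + i * (2 + n * 2))%N].
suff : row_inv m st' by move=> [_].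
have mE : nat_eval st (NReg 0) = m by [].
rewrite -{1}mE; apply: exec_For => [|i st1 _ [[m1 n1 h71] h11 t1]].
  by split=> //=; lia.
set st2 := tick 1 _.
pose entry_inv j st3 := [/\ keep st3, reg st3 5 = i,
  arr st3 1 = (fun a b => if (a < i)%N && (b < n)%N || (a == i) && (b < j)%N
                          then arr st 7 a b else arr st 1 a b)
  & (time st3 = time st2 + 1 + j * 2)%N].
have nE : nat_eval st2 (NReg 1) = n by [].
set st3 := exec _ _; suff [K3 _ h13 t3] : entry_inv n st3.
  split=> //; last by rewrite t3 /= t1 mulSn; lia.
  rewrite h13; apply/funext => a; apply/funext => b.
  by rewrite -andb_orl orbC -leq_eqVlt -ltnS.
rewrite -{1}nE; apply: exec_For.
  split=> //=; last by lia.
  by rewrite h11; apply/funext => a; apply/funext => b; rewrite andbF orbF.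
move=> j st4 _ [[m4 n4 h74] i4 h14 t4].
split=> //=; last by rewrite t4 /=; lia.
rewrite h14 h74 i4; apply/funext => a; apply/funext => b.
rewrite ltnS (leq_eqVlt b); case: (a =P i) => [->|_] /=; last by rewrite !orbF.
by case: (b =P j) => [->|_] //=; rewrite orbT.
Qed.

End Phases.
End Execution.

(** * Singular values as a sequence over all naturals *)

Section SingularValues.
Context {R : realType} {m n : nat} {C : 'M[R]_(m, n)}.
Context {U : 'M[R]_(m, minn m n)} {s : 'rV[R]_(minn m n)}.
Context {V : 'M[R]_(n, minn m n)}.
Hypothesis svdC : is_svd C U s V.

Lemma singular_values_ge0 i : 0 <= array_of_mx s 0 i.
Proof.
have [_ _ s0 _ _] := svdC; rewrite /array_of_mx.
by case: insub => [i0|//]; case: insub => [i'|//]; rewrite (ord1 i0).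
Qed.

(** Past the end the array reads 0, which is below every singular value. *)
Lemma singular_values_decr i j : (i <= j)%N ->
  array_of_mx s 0 j <= array_of_mx s 0 i.
Proof.
have [_ _ s0 s_decr _] := svdC.
rewrite /array_of_mx; case: insubP => // i0 _ i0E ij; rewrite (ord1 i0).
case: insubP => [j' jq j'E|_]; case: insubP => [i' _ i'E|iq] //.
  by rewrite s_decr// i'E j'E.
by move: iq; rewrite (leq_ltn_trans ij jq).
Qed.

Lemma svdE : C = U *m diag_mx (\row_i array_of_mx s 0 i) *m V^T.
Proof.
have [_ _ _ _ CE] := svdC; rewrite [LHS]CE; congr (_ *m diag_mx _ *m _).
by apply/rowP => i; rewrite mxE (array_of_mxE s ord0).
Qed.

End SingularValues.

(** * Correctness and cost of the two programs *)

Section Correctness.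
Variables (R : realType) (svd : svd_solver R) (svd_time : nat -> nat -> nat).
Hypothesis svd_ok : svd_correct svd.
Variables (m n : nat) (C : 'M[R]_(m, n)) (r : nat).
Hypothesis r_bounds : (0 < r <= minn m n)%N.

Let D := svd C.
Let U := array_of_mx (left_vectors D).
Let V := array_of_mx (right_vectors D).
Let sigma := array_of_mx (singular_values D) 0.

Let sigma_ge0 := singular_values_ge0 (svd_ok C).
Let sigma_decr := singular_values_decr (svd_ok C).

Lemma level_searchP tape :
  let st := exec svd svd_time tape level_search (initial_state C r) in
  exists k, [/\ env m n r U V sigma k st, fresh st,
    search_inv sigma (minn m n) r r k (arr st 6 0 0)
    & (time st <= svd_time m n + 4 + minn m n * 2 + r * 4)%N].
Proof.
move=> st; have /andP[r_gt0 r_le] := r_bounds.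
pose st1 := exec svd svd_time tape svd_and_rank (initial_state C r).
have [E1 F1 S1 t1] : [/\ env m n r U V sigma 0 st1, fresh st1, arr st1 6 0 0 = 0
    & (time st1 <= svd_time m n + 2)%N].
  rewrite /st1 /= array_of_mxK -/D; case: ifP => mn; split=> //=; try lia.
    by split; split=> //; apply/esym/minn_idPl.
  by split; split=> //; apply/esym/minn_idPr/ltnW; rewrite ltnNge mn.
have [E2 F2 S2 t2] := sum_singular_valuesP svd svd_time tape E1 F1 S1.
have [k [E3 F3 S3 t3]] :=
  water_level_loopP svd svd_time tape r_bounds sigma_ge0 sigma_decr E2 F2 S2.
by exists k; split=> //; apply: (leq_trans t3); rewrite t2; lia.
Qed.

(* Everything up to the random draw is independent of the tape, hence so is the
   water level. *)
Lemma factored_programP : exists t, water_level sigma (minn m n) r t /\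
  forall tape, let st := run svd svd_time tape factored_program C r in
    let theta := unit_clamp (tape 0%N) in
    [/\ exists k, env m n r U V sigma k st,
      factored_output m n r st =
        left_vectors D *m diag_mx (\row_i weight sigma t theta i) *m
        (right_vectors D)^T
      & (time st <= svd_time m n + 29 * (m * n))%N].
Proof.
have /andP[r_gt0 r_le] := r_bounds.
have [k [E1 F1 S1 t1]] := level_searchP (fun=> 0).
set st1 := exec _ _ _ _ _ in E1 F1 S1 t1.
pose t := arr st1 6 0 0 / (r - k)%:R.
have wl : water_level sigma (minn m n) r t.
  exact (search_water_level sigma_ge0 r_le sigma_decr S1).
exists t; split=> // tape st theta.
pose st2 := exec svd svd_time tape set_level_and_draw st1.
have -> : st = exec svd svd_time tape sample_components st2.
  rewrite /st /run (exec_Seq _ _ _ level_search).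
  rewrite (exec_Seq _ _ _ set_level_and_draw).
  by rewrite (level_search_tape _ _ _ (fun=> 0)).
have [E2 [c2 A2] T2 th2 t2] := set_level_and_drawP svd svd_time tape E1 F1 S1.
have th01 : 0 <= arr st2 6 0 1 < 1.
  by rewrite th2 /unit_clamp; case: ifP; rewrite ?lexx ?ltr01.
have [E3 [_ _ outE t3]] := sample_componentsP svd svd_time tape sigma_ge0
  E2 c2 A2 wl T2 th01.
split; first by exists k.
- apply/matrixP => i j; rewrite !mxE.
  under eq_bigr do rewrite !mxE.
  rewrite outE// th2; apply: eq_bigr => l _.
  rewrite mul_mx_diag !mxE /U /V !array_of_mxE -/theta; ring.
- apply: (leq_trans t3).
  (* With [q = minn m n], the overhead is at most [11 + 14 q + 2 q m + 2 q n]; bounding [q], [q m]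
     and [q n] by [m n] gives [29 = 11 + 14 + 4]. *)
  have q_gt0 : (0 < minn m n)%N := leq_trans r_gt0 r_le.
  have m_gt0 : (0 < m)%N := leq_trans q_gt0 (geq_minl _ _).
  have n_gt0 : (0 < n)%N := leq_trans q_gt0 (geq_minr _ _).
  have qm : (minn m n * m <= m * n)%N by rewrite mulnC leq_mul2l geq_minr orbT.
  have qn : (minn m n * n <= m * n)%N by rewrite leq_mul2r geq_minl orbT.
  have q_mn : (minn m n <= m * n)%N.
    by apply: leq_trans qm; rewrite leq_pmulr.
  have mn_gt0 : (0 < m * n)%N by rewrite muln_gt0 m_gt0.
  have -> : (minn m n * (8 + m * 2 + n * 2) =
    minn m n * 8 + minn m n * m * 2 + minn m n * n * 2)%N.
    by rewrite !mulnDr !mulnA.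
  move: t1 t2 r_le qm qn q_mn mn_gt0.
  rewrite -/st2; set a := (minn m n * m)%N; set b := (minn m n * n)%N.
  by set c := (m * n)%N; set q := minn m n; lia.
Qed.

Lemma explicit_programP tape :
  let st := run svd svd_time tape factored_program C r in
  let st' := run svd svd_time tape explicit_program C r in
  explicit_output m n r st' = factored_output m n r st /\
  (time st' <= time st + 12 * (m * n * minn m n))%N.
Proof.
have /andP[r_gt0 r_le] := r_bounds.
move=> st st'; have [t [_ /(_ tape)[[k E] _ _]]] := factored_programP.
have [[m1 n1 r1] h71 t1] := multiply_factorsP svd svd_time tape E.
have [h12 t2] := copy_productP svd svd_time tape m1 n1.
split.
  apply/matrixP => i j; rewrite !mxE h12 h71 !ltn_ord.
  by apply: eq_bigr => l _; rewrite !mxE.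
change (time st' = time (exec svd svd_time tape multiply_factors st) + 1 +
          m * (2 + n * 2))%N in t2.
rewrite t2 t1 -/st.
(* The two phases cost [2 + 4 m + 4 m n + 2 m n r], whence [12 = 2 + 4 + 4 + 2]. *)
have q_gt0 : (0 < minn m n)%N := leq_trans r_gt0 r_le.
have m_gt0 : (0 < m)%N := leq_trans q_gt0 (geq_minl _ _).
have n_gt0 : (0 < n)%N := leq_trans q_gt0 (geq_minr _ _).
have mn_gt0 : (0 < m * n)%N by rewrite muln_gt0 m_gt0.
have mn_le : (m * n <= m * n * minn m n)%N by rewrite leq_pmulr.
have m_le : (m <= m * n)%N by rewrite leq_pmulr.
have mnr_le : (m * n * r <= m * n * minn m n)%N by rewrite leq_mul2l r_le orbT.
have -> : (m * (2 + n * (2 + r * 2)) = m * 2 + m * n * 2 + m * n * r * 2)%N.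
  by rewrite !mulnDr !mulnA addnA.
have -> : (m * (2 + n * 2) = m * 2 + m * n * 2)%N by rewrite !mulnDr !mulnA.
move: mn_gt0 mn_le m_le mnr_le; set a := (m * n * r)%N.
by set b := (m * n * minn m n)%N; set c := (m * n)%N; lia.
Qed.

End Correctness.

(** * Existence and computation of optimal approximators *)

Section OptimalApproximators.
Variable R : realType.

(** The decomposition comes from [svd_exists] and not from a solver; the sample space is the real
    line with the uniform law on the unit interval. *)
Lemma optimal_approximator_exists m n (C : 'M[R]_(m, n)) r :
  (0 < r <= minn m n)%N ->
  exists (d : measure_display) (T : measurableType d) (P : probability T R)
    (C' : T -> 'M[R]_(m, n)), optimal_approximator P C' C r.
Proof.
move=> /andP[r_gt0 r_le].
have [U [s [V svdC]]] := svd_exists C; have [UU VV _ _ _] := svdC.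
have [t wl] := water_level_exists (singular_values_ge0 svdC) r_gt0 r_le
  (singular_values_decr svdC).
pose sigma := array_of_mx s 0.
pose C' (w : measurableTypeR R) : 'M[R]_(m, n) :=
  U *m diag_mx (\row_i weight sigma t (unit_clamp w) i) *m V^T.
exists _, (measurableTypeR R), (uniform_prob (@ltr01 R)), C'.
apply: (systematic_sampling_optimal UU VV (singular_values_ge0 svdC)
          (svdE svdC) wl) => //.
exact: (@uniform_unit_clamp R _ (measurableTypeR R)
          (uniform_prob (@ltr01 R)) id).
Qed.

Lemma factored_program_optimal (svd : svd_solver R) svd_time m n
    (C : 'M[R]_(m, n)) r d (T : measurableType d) (P : probability T R)
    (u : nat -> {RV P >-> R}) :
  svd_correct svd -> (0 < r <= minn m n)%N -> iid_uniform u ->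
  optimal_approximator P
    (fun w => factored_output m n r
       (run svd svd_time (fun k => u k w) factored_program C r)) C r.
Proof.
move=> svd_ok r_bounds [u_unif _].
have [t [wl outE]] := factored_programP svd_time svd_ok C r_bounds.
have [UU VV _ _ _] := svd_ok m n C.
apply: (systematic_sampling_optimal UU VV (singular_values_ge0 (svd_ok m n C))
          (svdE (svd_ok m n C)) wl).
  apply: (uniform_unit_clamp (f := u 0%N)) => //.
  exact: u_unif.
by move=> w; have [_ -> _] := outE (fun k => u k w).
Qed.

End OptimalApproximators.

Local Close Scope ring_scope.
Local Close Scope classical_set_scope.

Theorem theorem2 (R : realType) :
  (forall (m n : nat) (C : 'M[R]_(m, n)) (r : nat), (0 < r <= minn m n)%N ->
     exists (d : measure_display) (T : measurableType d)
       (P : probability T R) (C' : T -> 'M[R]_(m, n)),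
       optimal_approximator P C' C r)
  /\
  (exists (c : program) (K : nat),
     optimal_in_svd_time c K (@factored_output R) (fun m n => m * n)%N)
  /\
  (exists (c : program) (K : nat),
     optimal_in_svd_time c K (@explicit_output R)
       (fun m n => m * n * minn m n)%N).
Proof.
split; first exact: optimal_approximator_exists.
split.
  exists factored_program, 30%N.
  move=> svd svd_time svd_ok svd_time_ge m n C r r_bounds.
  split=> [tape|d T P u]; last exact: factored_program_optimal.
  have [t [_ /(_ tape)[_ _ time_le]]] :=
    factored_programP svd_time svd_ok C r_bounds.
  have := svd_time_ge m n; lia.
(* [42 = 1 + 29 + 12]: the decomposition, the sampling overhead and the multiplication. *)
exists explicit_program, 42%N.
move=> svd svd_time svd_ok svd_time_ge m n C r r_bounds.
split=> [tape|d T P u u_unif].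
  have [t [_ /(_ tape)[_ _ time_le]]] :=
    factored_programP svd_time svd_ok C r_bounds.
  have [_ time_le'] := explicit_programP svd_time svd_ok C r_bounds tape.
  have mn_le : (m * n <= m * n * minn m n)%N.
    by rewrite leq_pmulr//; case/andP: r_bounds; exact: leq_trans.
  have := svd_time_ge m n; lia.
have -> : (fun w => explicit_output m n r
    (run svd svd_time (fun k => u k w) explicit_program C r)) =
  (fun w => factored_output m n r
    (run svd svd_time (fun k => u k w) factored_program C r)).
  apply/funext => w.
  by have [-> _] := explicit_programP svd_time svd_ok C r_bounds
    (fun k => u k w).
exact: factored_program_optimal.
Qed.
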